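(* Let either $\theta=0$ and $n\in(0,3/2)$, or $\theta>0$ and $n\in(0,3)$. For any $\delta>0$ sufficiently small, there exists a connecting orbit between $\mathcal B_\delta^\theta$ and $\mathcal B_1$. The orbit is unique if $H>0$ for all $x\in(0,1]$.
   Context: Consider the autonomous first-order system in $\mathbb R^4$ with phase-space variables $(x,H,H',H'')$, $$\frac{d}{d\tau}\begin{pmatrix}x\\H\\H'\\H''\end{pmatrix}=\begin{pmatrix}1\\H'\\H''\\H^{1-n}(x-1)\end{pmatrix},$$ which is equivalent to the third-order equation $H^{n-1}\frac{d^3H}{dx^3}=-1+x$ (for $H>0$). Let $$\mathcal B_0^\theta=\{x=0,\ H=0,\ H'=\theta\},\qquad \mathcal B_1=\{x=1,\ H'=0\}$$ be the boundary manifolds. For small $\delta>0$, $\mathcal B_\delta^\theta$ denotes the intersection with $\{x=\delta\}$ of the solution curves emanating from $\mathcal B_0^\theta$ (under the flow for small times), i.e. the set of points $(\delta,H(\delta),\frac{dH}{dx}(\delta),\frac{d^2H}{dx^2}(\delta))$ for solutions $H>0$ on $(0,\delta]$ of $H^{n-1}\frac{d^3H}{dx^3}=-1+x$ with $(H,\frac{dH}{dx})\to(0,\theta)$ as $x\searrow0$. A connecting orbit between $\mathcal B_\delta^\theta$ and $\mathcal B_1$ is a trajectory of the system starting at a point of $\mathcal B_\delta^\theta$ (at $x=\delta$) and ending at a point of $\mathcal B_1$ (at $x=1$). *)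

(* Defs.v *)
From Stdlib Require Import Reals.
From Coquelicot Require Import Coquelicot.

Open Scope R_scope.

(* A point (x, H, H', H''). *)
Definition phase_space : Type := (R * R * R * R)%type.

Definition coord_x (p : phase_space) : R := let '(x, _, _, _) := p in x.
Definition coord_H (p : phase_space) : R := let '(_, h, _, _) := p in h.
Definition coord_H' (p : phase_space) : R := let '(_, _, h', _) := p in h'.

(* [Rpower h a] is the real power only for h > 0 (for example [Rpower 0 a] is
   1 for every a), so the value at 0 is set separately: 0^a = 0 for a > 0 and
   0^0 = 1.  The values for h < 0, and for h = 0 > a, carry no meaning and are
   excluded by [pow_defined]. *)
Definition rpow (h a : R) : R :=
  if Rlt_dec 0 h then Rpower h a
  else if Req_EM_T a 0 then 1 else 0.

Definition pow_defined (h a : R) : Prop := 0 < h \/ (h = 0 /\ 0 <= a).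

Definition vector_field (n : R) (p : phase_space) : phase_space :=
  let '(x, h, h', h'') := p in (1, h', h'', rpow h (1 - n) * (x - 1)).

(* The curve must stay where the vector field is defined.  Only the values of
   [u] on [0, T] matter: derivatives are two-sided at the end points as well,
   which is no restriction, since a curve differentiable on [0, T] in the
   one-sided sense extends affinely to a curve on R. *)
Definition trajectory (n T : R) (u : R -> phase_space) : Prop :=
  forall t : R, 0 <= t <= T ->
    pow_defined (coord_H (u t)) (1 - n) /\
    is_derive u t (vector_field n (u t)).

(* H > 0 on (0, delta] solves H^(n-1) H''' = -1 + x there.  As above, asking
   for two-sided derivatives at delta is harmless: extend by the cubic Taylor
   polynomial. *)
Definition positive_solution (n delta : R) (H : R -> R) : Prop :=
  forall x : R, 0 < x <= delta ->
    0 < H x /\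
    (forall k : nat, (k <= 3)%nat -> ex_derive_n H k x) /\
    Rpower (H x) (n - 1) * Derive_n H 3 x = -1 + x.

(* (x, H, H') -> (0, 0, theta); no condition on H'', which may be unbounded. *)
Definition emanates_from_B0 (theta : R) (H : R -> R) : Prop :=
  filterlim H (at_right 0) (locally 0) /\
  filterlim (Derive H) (at_right 0) (locally theta).

Definition B_delta (n theta delta : R) (p : phase_space) : Prop :=
  exists H : R -> R,
    positive_solution n delta H /\
    emanates_from_B0 theta H /\
    p = (delta, H delta, Derive H delta, Derive_n H 2 delta).

Definition B1 (p : phase_space) : Prop := coord_x p = 1 /\ coord_H' p = 0.

(* An orbit is the set of points traversed by a trajectory, so that orbits are
   compared independently of their parametrization. *)
Definition connecting_orbit (n theta delta : R) (O : phase_space -> Prop) :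
    Prop :=
  exists (T : R) (u : R -> phase_space),
    0 <= T /\ trajectory n T u /\
    B_delta n theta delta (u 0) /\ B1 (u T) /\
    forall p : phase_space, O p <-> exists t : R, 0 <= t <= T /\ p = u t.

(* This is H > 0 for x in [delta, 1]; on (0, delta] positivity is part of the
   definition of [B_delta]. *)
Definition positive_orbit (O : phase_space -> Prop) : Prop :=
  forall p : phase_space, O p -> 0 < coord_H p.

(* Main.v *)
Require Import Defs.
From Stdlib Require Import Reals Lra Lia ClassicalEpsilon.
From Coquelicot Require Import Coquelicot.

Open Scope R_scope.

(* A positive orbit is a solution on (0, 1] of H''' = -(1 - x) H^(1-n) with
   H(0) = 0, H'(0) = theta, H'(1) = 0.  Since H' is concave, such problems obey
   a maximum principle.

   Existence.  For n <= 1, and for theta = 0, the map sending a right hand side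
   to the solution preserves order and |1 - n| < 1, so it yields a contraction
   for the distance sup |ln H1 - ln H2|.  For theta > 0 and n > 1 the maximum
   principle gives H >= theta x / 2, so the nonlinearity may be truncated below
   that line; the truncated equation with H''(r) = a, r small, is solved by a
   contraction in a weighted norm, H'(1) depends on a in a Lipschitz way, and it
   differs from theta + a by a bounded amount, so it vanishes for some a.

   Uniqueness.  For n < 1, H1 <= lambda H2 implies H1 <= lambda^(1-n) H2, and
   iteration gives H1 <= H2.  For n >= 1 there is an energy argument. *)

(** * Calculus at the singular end point *)

(** The ranges of [n] come from the behaviour at the singular end. For [theta = 0] solutions are of
    order [x^2], and [x^(2(1-n))] is integrable at 0 exactly when [n < 3/2]. For [theta > 0] they
    are of order [x], and [H'] has a limit at 0 as soon as [x^(1-n)] can be integrated twice, that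
    is for [n < 3]; [H''] may then blow up, so nothing is ever asked of it at 0. The logarithmic
    contraction stops at [n = 2], where its factor reaches 1. Shooting has no such barrier: above
    the line [theta x / 2] the nonlinearity is Lipschitz with a constant that is singular only at 0,
    and a small scale [r] in the weight absorbs that singularity. Improper integrals at 0 are
    avoided: primitives are taken from 1, and their size is controlled by comparison with explicit
    powers. In both existence proofs [1 - x] is replaced by its positive part, so that all unknowns
    live on the whole half line. *)

Definition right_limit (h : R -> R) (l : R) : Prop :=
  forall eps, 0 < eps ->
  exists d, 0 < d /\ forall x, 0 < x < d -> Rabs (h x - l) < eps.

Lemma right_limit_filterlim (h : R -> R) (l : R) :
  right_limit h l <-> filterlim h (at_right 0) (locally l).
Proof.
split.
- intros Hl; apply filterlim_locally; intros eps.
  destruct (Hl eps (cond_pos eps)) as [d [Hd Hx]].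
  exists (mkposreal d Hd); intros y Hy Hy0.
  apply Hx; split; [exact Hy0|].
  change (Rabs (y - 0) < d) in Hy.
  rewrite Rabs_pos_eq in Hy; lra.
- intros Hf eps He.
  destruct (proj1 (filterlim_locally h l) Hf (mkposreal eps He)) as [d Hd].
  exists d; split; [apply cond_pos|]; intros x Hx.
  apply (Hd x); [|lra].
  change (Rabs (x - 0) < d); rewrite Rabs_pos_eq; lra.
Qed.

Lemma right_limit_ext (g h : R -> R) (l : R) :
  (exists b, 0 < b /\ forall x, 0 < x < b -> g x = h x) ->
  right_limit g l -> right_limit h l.
Proof.
intros [b [Hb E]] Hg eps He; destruct (Hg eps He) as [d [Hd Hx]].
exists (Rmin b d); split; [now apply Rmin_pos|]; intros x Hx'.
assert (Rmin b d <= b) by apply Rmin_l; assert (Rmin b d <= d) by apply Rmin_r.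
rewrite <- E by lra; apply Hx; lra.
Qed.

Lemma right_limit_comb (g h : R -> R) (k l c : R) :
  right_limit g k -> right_limit h l ->
  right_limit (fun x => g x + c * h x) (k + c * l).
Proof.
intros Hg Hh eps He.
assert (Hc : 0 < 1 + Rabs c) by (pose proof (Rabs_pos c); lra).
destruct (Hg (eps / 2)) as [d1 [Hd1 H1]]; [lra|].
destruct (Hh (eps / (2 * (1 + Rabs c)))) as [d2 [Hd2 H2]].
{ apply Rdiv_lt_0_compat; lra. }
exists (Rmin d1 d2); split; [now apply Rmin_pos|]; intros x Hx.
assert (Rmin d1 d2 <= d1) by apply Rmin_l; assert (Rmin d1 d2 <= d2) by apply Rmin_r.
specialize (H1 x ltac:(lra)); specialize (H2 x ltac:(lra)).
replace (g x + c * h x - (k + c * l)) with ((g x - k) + c * (h x - l)) by ring.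
eapply Rle_lt_trans; [apply Rabs_triang|]; rewrite Rabs_mult.
assert (Rabs c * Rabs (h x - l) <= eps / 2); [|lra].
apply Rle_trans with ((1 + Rabs c) * (eps / (2 * (1 + Rabs c)))).
- apply Rmult_le_compat; try apply Rabs_pos; lra.
- right; field; lra.
Qed.

Lemma right_limit_dominated (G h : R -> R) :
  (exists b, 0 < b /\ forall x, 0 < x < b -> Rabs (h x) <= G x) ->
  right_limit G 0 -> right_limit h 0.
Proof.
intros [b [Hb E]] Hg eps He; destruct (Hg eps He) as [d [Hd Hx]].
exists (Rmin b d); split; [now apply Rmin_pos|]; intros x Hx'.
assert (Rmin b d <= b) by apply Rmin_l; assert (Rmin b d <= d) by apply Rmin_r.
specialize (Hx x ltac:(lra)); specialize (E x ltac:(lra)).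
rewrite Rminus_0_r in *.
apply Rle_lt_trans with (G x); [exact E|].
eapply Rle_lt_trans; [apply Rle_abs|exact Hx].
Qed.

Lemma right_limit_id : right_limit (fun x => x) 0.
Proof.
intros eps He; exists eps; split; [exact He|]; intros x Hx.
rewrite Rminus_0_r, Rabs_pos_eq; lra.
Qed.

Lemma right_limit_Rpower (a : R) : 0 < a -> right_limit (fun x => Rpower x a) 0.
Proof.
intros Ha eps He; exists (Rpower eps (/ a)); split; [apply exp_pos|].
intros x Hx; rewrite Rminus_0_r, Rabs_pos_eq by (left; apply exp_pos).
apply Rlt_le_trans with (Rpower (Rpower eps (/ a)) a).
- apply Rlt_Rpower_l; lra.
- rewrite Rpower_mult, Rinv_l, Rpower_1; lra.
Qed.

Lemma mean_value (h h' : R -> R) (a b : R) :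
  a < b -> (forall x, a <= x <= b -> is_derive h x (h' x)) ->
  exists c, a < c < b /\ h b - h a = h' c * (b - a).
Proof.
intros Hab Hd.
destruct (MVT_cor2 h h' a b Hab) as [c [Hc1 Hc2]].
- intros c Hc; apply is_derive_Reals; auto.
- now exists c.
Qed.

Lemma derive_nonneg_incr (h h' : R -> R) (a b : R) :
  a <= b -> (forall x, a <= x <= b -> is_derive h x (h' x)) ->
  (forall x, a < x < b -> 0 <= h' x) -> h a <= h b.
Proof.
intros [Hab| ->] Hd Hp; [|lra].
destruct (mean_value h h' a b Hab Hd) as [c [Hc E]].
assert (0 <= h' c * (b - a)) by (apply Rmult_le_pos; [auto|lra]); lra.
Qed.

(** Both [G + F] and [G - F] are nondecreasing. This takes the place of integral estimates
    throughout. *)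
Lemma increment_dominated (F G f g : R -> R) (a b : R) :
  a <= b ->
  (forall x, a <= x <= b -> is_derive F x (f x)) ->
  (forall x, a <= x <= b -> is_derive G x (g x)) ->
  (forall x, a < x < b -> Rabs (f x) <= g x) ->
  Rabs (F b - F a) <= G b - G a.
Proof.
intros Hab DF DG Hfg.
assert (G a + F a <= G b + F b).
{ apply (derive_nonneg_incr (fun z => G z + F z) (fun z => g z + f z)); [lra| |].
  - intros z Hz; apply (is_derive_plus G F); auto.
  - intros z Hz; specialize (Hfg z Hz).
    pose proof (Rcomplements.Rabs_maj2 (f z)); lra. }
assert (G a - F a <= G b - F b).
{ apply (derive_nonneg_incr (fun z => G z - F z) (fun z => g z - f z)); [lra| |].
  - intros z Hz; apply (is_derive_minus G F); auto.
  - intros z Hz; specialize (Hfg z Hz).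
    pose proof (Rle_abs (f z)); lra. }
apply Rabs_le; lra.
Qed.

(** If [h x < l], some [y <= x] close to 0 has [h y > h x], against monotonicity. *)
Lemma right_limit_le_incr (h h' : R -> R) (b l : R) :
  (forall x, 0 < x <= b -> is_derive h x (h' x)) ->
  (forall x, 0 < x < b -> 0 <= h' x) ->
  right_limit h l -> forall x, 0 < x <= b -> l <= h x.
Proof.
intros Hd Hp Hl x Hx.
destruct (Rle_lt_dec l (h x)) as [H|H]; [exact H|exfalso].
destruct (Hl (l - h x)) as [d [Hd0 Hd1]]; [lra|].
set (y := Rmin (d / 2) x).
assert (Hy : 0 < y) by (apply Rmin_pos; lra).
assert (y <= d / 2) by apply Rmin_l; assert (y <= x) by apply Rmin_r.
specialize (Hd1 y ltac:(lra)).
assert (h y <= h x).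
{ apply derive_nonneg_incr with h'; intros; try apply Hd; try apply Hp; lra. }
apply Rabs_def2 in Hd1; lra.
Qed.

(** The maximum principle. As [y1] is nonincreasing, either [y1 x <= 0] and [y] decreases from [x]
    to [b], so that [y x >= y b], or [y1 x > 0] and [y] increases on [(0, x]], so that
    [y x >= l]. *)
Lemma concave_nonneg (y y1 y2 : R -> R) (b l : R) :
  (forall x, 0 < x <= b -> is_derive y x (y1 x)) ->
  (forall x, 0 < x <= b -> is_derive y1 x (y2 x)) ->
  (forall x, 0 < x < b -> y2 x <= 0) ->
  right_limit y l -> 0 <= l -> 0 <= y b ->
  forall x, 0 < x <= b -> 0 <= y x.
Proof.
intros D1 D2 Hc Hl Hl0 Hb x Hx.
assert (Hdec : forall s t, 0 < s <= t -> t <= b -> y1 t <= y1 s).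
{ intros s t Hs Ht.
  assert (- y1 s <= - y1 t); [|lra].
  apply (derive_nonneg_incr (fun z => - y1 z) (fun z => - y2 z)); [lra| |].
  - intros z Hz; apply (is_derive_opp y1); apply D2; lra.
  - intros z Hz; specialize (Hc z ltac:(lra)); lra. }
destruct (Rle_lt_dec (y1 x) 0) as [H|H].
- assert (- y x <= - y b); [|lra].
  apply (derive_nonneg_incr (fun z => - y z) (fun z => - y1 z)); [lra| |].
  + intros z Hz; apply (is_derive_opp y); apply D1; lra.
  + intros z Hz; specialize (Hdec x z ltac:(lra) ltac:(lra)); lra.
- apply Rle_trans with l; [exact Hl0|].
  apply (right_limit_le_incr y y1 x); [| |exact Hl|lra].
  + intros z Hz; apply D1; lra.
  + intros z Hz; specialize (Hdec z x ltac:(lra) ltac:(lra)); lra.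
Qed.

Lemma is_derive_RInt_pos (f : R -> R) :
  (forall x, 0 < x -> continuous f x) ->
  forall x, 0 < x -> is_derive (fun z => RInt f 1 z) x (f x).
Proof.
intros Cf x Hx; apply is_derive_RInt with 1; [|now apply Cf].
exists (mkposreal x Hx); intros y Hy.
change (Rabs (y - x) < x) in Hy; apply Rabs_def2 in Hy.
apply RInt_correct, ex_RInt_continuous; intros z Hz; apply Cf.
assert (0 < Rmin 1 y) by (apply Rmin_pos; lra); lra.
Qed.

Lemma is_derive_continuous (u : R -> R) (x u' : R) : is_derive u x u' -> continuous u x.
Proof.
intros Hu; apply (ex_derive_continuous (K := R_AbsRing) (V := R_NormedModule)); now exists u'.
Qed.

(** When [G] tends to 0 at 0 this yields the primitive vanishing at 0. The constant [L] added to the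
    primitive [P] must satisfy [- (G y + P y) <= L <= G x - P x] for all [x] and [y]; every lower
    bound is below every upper bound by monotonicity of [G + P] and [G - P], so the supremum of the
    lower bounds serves. *)
Lemma dominated_primitive (f g G : R -> R) :
  (forall x, 0 < x -> continuous f x) ->
  (forall x, 0 < x -> is_derive G x (g x)) ->
  (forall x, 0 < x -> Rabs (f x) <= g x) ->
  (forall x, 0 < x -> 0 <= G x) ->
  exists F : R -> R,
    (forall x, 0 < x -> is_derive F x (f x)) /\
    (forall x, 0 < x -> Rabs (F x) <= G x).
Proof.
intros Cf DG Hfg HG.
set (P := fun x => RInt f 1 x).
assert (DP : forall x, 0 < x -> is_derive P x (f x)).
{ exact (is_derive_RInt_pos f Cf). }
assert (M : forall x y, 0 < x <= y -> Rabs (P y - P x) <= G y - G x).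
{ intros x y Hxy; apply increment_dominated with f g; intros;
    [lra|apply DP|apply DG|apply Hfg]; lra. }
assert (Mc : forall x y, 0 < x -> 0 < y -> - (G y + P y) <= G x - P x).
{ intros x y Hx Hy; destruct (Rle_lt_dec x y) as [H|H].
  - specialize (M x y ltac:(lra)); specialize (HG x Hx); apply Rabs_le_between in M; lra.
  - specialize (M y x ltac:(lra)); specialize (HG y Hy); apply Rabs_le_between in M; lra. }
destruct (completeness (fun z => exists y, 0 < y /\ z = - (G y + P y))) as [L [HL1 HL2]].
- exists (G 1 - P 1); intros z [y [Hy ->]]; apply Mc; lra.
- exists (- (G 1 + P 1)), 1; split; [lra|reflexivity].
- exists (fun x => P x + L); split.
  + intros x Hx; replace (f x) with (f x + 0) by ring.
    apply (is_derive_plus P (fun _ => L)); [now apply DP|].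
    apply (is_derive_const (K := R_AbsRing) (V := R_NormedModule)).
  + intros x Hx.
    assert (- (G x + P x) <= L) by (apply HL1; now exists x).
    assert (L <= G x - P x) by (apply HL2; intros z [y [Hy ->]]; now apply Mc).
    apply Rabs_le; lra.
Qed.

(** * The linear third-order problem *)

Lemma is_derive_power (a x : R) :
  0 < x -> is_derive (fun t => Rpower t a) x (a * Rpower x (a - 1)).
Proof. intros Hx; apply is_derive_Reals, derivable_pt_lim_power, Hx. Qed.

Lemma Rpower_pos (x a : R) : 0 < Rpower x a.
Proof. apply exp_pos. Qed.

(** The linear problem [h0''' = - f] with data 0 and [theta] at 0. The derivatives are separate
    functions, so that linear combinations need no [Derive], and [h2] is unconstrained at 0, where
    it may be unbounded. *)
Definition triple (f : R -> R) (b theta : R) (h0 h1 h2 : R -> R) : Prop :=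
  (forall x, 0 < x <= b ->
     is_derive h0 x (h1 x) /\ is_derive h1 x (h2 x) /\ is_derive h2 x (- f x)) /\
  right_limit h0 0 /\ right_limit h1 theta.

Lemma triple_comb (f g h0 h1 h2 k0 k1 k2 : R -> R) (b s t c : R) :
  triple f b s h0 h1 h2 -> triple g b t k0 k1 k2 ->
  triple (fun x => f x + c * g x) b (s + c * t)
    (fun x => h0 x + c * k0 x) (fun x => h1 x + c * k1 x) (fun x => h2 x + c * k2 x).
Proof.
intros [Dh [Lh0 Lh1]] [Dk [Lk0 Lk1]].
assert (D : forall u v x u' v', is_derive u x u' -> is_derive v x v' ->
              is_derive (fun z => u z + c * v z) x (u' + c * v')).
{ intros u v x u' v' Hu Hv; apply (is_derive_plus u (fun z => c * v z)); [exact Hu|].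
  apply (is_derive_scal v); exact Hv. }
split; [|split].
- intros x Hx; destruct (Dh x Hx) as [A0 [A1 A2]], (Dk x Hx) as [B0 [B1' B2]].
  split; [|split]; try now apply D.
  replace (- (f x + c * g x)) with (- f x + c * - g x) by ring; now apply D.
- replace 0 with (0 + c * 0) by ring; now apply right_limit_comb.
- now apply right_limit_comb.
Qed.

(** The homogeneous solutions. They act as barriers in comparisons, and adding one adjusts the free
    constant that fixes [h1 1] or [h2 r]. *)
Lemma triple_quadratic (b theta a : R) :
  triple (fun _ => 0) b theta
    (fun x => theta * x + a * (x ^ 2 / 2)) (fun x => theta + a * x) (fun _ => a).
Proof.
split; [|split].
- intros x Hx; split; [|split]; auto_derive; auto; field.
- replace 0 with (0 + theta * 0 + a * 0) by ring.
  apply right_limit_comb.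
  + apply (right_limit_ext (fun x => 0 + theta * x)).
    * exists 1; split; [lra|intros; ring].
    * apply (right_limit_comb (fun _ => 0)); [|apply right_limit_id].
      intros eps He; exists 1; split; [lra|]; intros.
      rewrite Rminus_0_r, Rabs_R0; exact He.
  + apply (right_limit_dominated (fun x => x)); [|apply right_limit_id].
    exists 1; split; [lra|]; intros x Hx; rewrite Rabs_pos_eq; nra.
- pattern theta at 2; replace theta with (theta + a * 0) by ring.
  apply (right_limit_comb (fun _ => theta)); [|apply right_limit_id].
  intros eps He; exists 1; split; [lra|]; intros.
  rewrite Rminus_diag, Rabs_R0; exact He.
Qed.

Lemma triple_ext (f g h0 h1 h2 k0 k1 k2 : R -> R) (b s t : R) :
  (forall x, 0 < x -> f x = g x /\ h0 x = k0 x /\ h1 x = k1 x /\ h2 x = k2 x) ->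
  s = t -> triple f b s h0 h1 h2 -> triple g b t k0 k1 k2.
Proof.
intros E <- [D [L0 L1]].
assert (Hn : forall x, 0 < x -> locally x (fun z => 0 < z)) by (apply open_gt).
split; [|split].
- intros x Hx; destruct (D x Hx) as [A0 [A1 A2]].
  destruct (E x ltac:(lra)) as [<- [_ [<- <-]]].
  split; [|split]; (eapply is_derive_ext_loc; [|eassumption]);
    apply (filter_imp (fun z => 0 < z)); try (apply Hn; lra);
    intros z Hz; apply E, Hz.
- eapply right_limit_ext; [|exact L0]; exists 1; split; [lra|intros x Hx; apply E; lra].
- eapply right_limit_ext; [|exact L1]; exists 1; split; [lra|intros x Hx; apply E; lra].
Qed.

Lemma triple_ext_rhs (f g h0 h1 h2 : R -> R) (b theta : R) :
  (forall x, 0 < x <= b -> f x = g x) ->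
  triple f b theta h0 h1 h2 -> triple g b theta h0 h1 h2.
Proof.
intros E [D L]; split; [|exact L]; intros x Hx; rewrite <- E by exact Hx; now apply D.
Qed.

(** The singularity [x^(-beta)] is integrated three times: [h2] is of order [x^(1-beta)] and may
    blow up, while [beta < 2] makes [h1], and then [h0], tend to 0. Taking [beta > 1] rules out a
    logarithm in the bound of [h2]; a milder singularity is covered by raising its exponent. *)
Lemma triple_exists (f : R -> R) (C beta : R) :
  1 < beta < 2 -> 0 <= C ->
  (forall x, 0 < x -> continuous f x) ->
  (forall x, 0 < x -> Rabs (f x) <= C * Rpower x (- beta)) ->
  exists h0 h1 h2, forall b, triple f b 0 h0 h1 h2.
Proof.
intros Hb HC Cf Bf.
set (P := fun x => RInt f 1 x).
assert (DP : forall x, 0 < x -> is_derive P x (f x)).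
{ exact (is_derive_RInt_pos f Cf). }
assert (P1 : P 1 = 0) by (unfold P; rewrite RInt_point; reflexivity).
set (K := C / (beta - 1)).
assert (HK : 0 <= K) by (apply Rcomplements.Rdiv_le_0_compat; lra).
assert (BP : forall x, 0 < x -> Rabs (- P x) <= K * (Rpower x (1 - beta) + 1)).
{ intros x Hx; rewrite Rabs_Ropp.
  assert (M : forall s t, 0 < s <= t ->
            Rabs (P t - P s) <= - K * Rpower t (1 - beta) - - K * Rpower s (1 - beta)).
  { intros s t Hst.
    apply (increment_dominated P (fun z => - K * Rpower z (1 - beta)) f
             (fun z => C * Rpower z (- beta))); [lra| | |].
    - intros z Hz; apply DP; lra.
    - intros z Hz.
      replace (C * Rpower z (- beta)) with (- K * ((1 - beta) * Rpower z (1 - beta - 1))).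
      + apply is_derive_scal, is_derive_power; lra.
      + replace (1 - beta - 1) with (- beta) by ring; unfold K; field; lra.
    - intros z Hz; apply Bf; lra. }
  assert (Hp := Rpower_pos x (1 - beta)).
  assert (H1 : Rpower 1 (1 - beta) = 1) by (unfold Rpower; rewrite ln_1, Rmult_0_r; apply exp_0).
  assert (0 <= K * Rpower x (1 - beta)) by (apply Rmult_le_pos; lra).
  destruct (Rle_lt_dec x 1) as [Hx1|Hx1].
  - specialize (M x 1 ltac:(lra)); rewrite P1, H1 in M.
    rewrite Rminus_0_l, Rabs_Ropp in M; lra.
  - specialize (M 1 x ltac:(lra)); rewrite P1, H1 in M.
    rewrite Rminus_0_r in M; lra. }
(* [G1] and [G0] are the successive primitives, vanishing at 0, of the bound
   [K * (Rpower x (1 - beta) + 1)] on [P]. *)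
set (G1 := fun x => K * (Rpower x (2 - beta) / (2 - beta) + x)).
set (G0 := fun x => K * (Rpower x (3 - beta) / ((2 - beta) * (3 - beta)) + x ^ 2 / 2)).
assert (DP' : forall x, 0 < x -> is_derive (fun z => - P z) x (- f x)).
{ intros x Hx; apply (is_derive_opp P); auto. }
assert (DPow : forall a x, 0 < x -> 0 < a ->
   is_derive (fun z => Rpower z a / a) x (Rpower x (a - 1))).
{ intros a x Hx Ha.
  replace (Rpower x (a - 1)) with (/ a * (a * Rpower x (a - 1))) by (field; lra).
  apply (is_derive_ext (fun z => / a * Rpower z a)); [intros; apply Rmult_comm|].
  apply is_derive_scal, is_derive_power, Hx. }
destruct (dominated_primitive (fun x => - P x)
            (fun x => K * (Rpower x (1 - beta) + 1)) G1) as [h1 [Dh1 Bh1]].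
- intros x Hx; eapply is_derive_continuous; apply DP'; exact Hx.
- intros x Hx; unfold G1; apply is_derive_scal.
  apply (is_derive_plus (fun z => Rpower z (2 - beta) / (2 - beta)) (fun z => z)).
  + replace (1 - beta) with (2 - beta - 1) by ring; apply DPow; lra.
  + apply (is_derive_id (K := R_AbsRing)).
- exact BP.
- intros x Hx; apply Rmult_le_pos; [exact HK|].
  assert (0 <= Rpower x (2 - beta) / (2 - beta)); [|lra].
  apply Rcomplements.Rdiv_le_0_compat; [left; apply Rpower_pos|lra].
- destruct (dominated_primitive h1 G1 G0) as [h0 [Dh0 Bh0]].
  + intros x Hx; eapply is_derive_continuous; apply Dh1; exact Hx.
  + intros x Hx; unfold G0, G1; apply is_derive_scal.
    apply (is_derive_plus (fun z => Rpower z (3 - beta) / ((2 - beta) * (3 - beta)))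
             (fun z => z ^ 2 / 2)).
    * apply (is_derive_ext (fun z => / (2 - beta) * (Rpower z (3 - beta) / (3 - beta)))).
      { intros z; lazymatch goal with |- @eq _ ?u ?v => change (@eq R u v) end; field; lra. }
      replace (Rpower x (2 - beta) / (2 - beta)) with (/ (2 - beta) * Rpower x (3 - beta - 1)).
      { apply is_derive_scal, DPow; lra. }
      replace (3 - beta - 1) with (2 - beta) by ring; apply Rmult_comm.
    * auto_derive; auto; field.
  + exact Bh1.
  + intros x Hx; apply Rmult_le_pos; [exact HK|].
    assert (0 <= Rpower x (3 - beta) / ((2 - beta) * (3 - beta))); [|nra].
    apply Rcomplements.Rdiv_le_0_compat; [left; apply Rpower_pos|nra].
  + exists h0, h1, (fun x => - P x); intros b; split; [|split].
    * intros x Hx; split; [|split]; auto with real; [apply Dh0|apply Dh1|apply DP']; lra.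
    * apply (right_limit_dominated G0); [exists 1; split; [lra|]; intros x Hx; apply Bh0; lra|].
      replace 0 with (0 + K / ((2 - beta) * (3 - beta)) * 0) by ring.
      apply (right_limit_ext
        (fun x => K * x ^ 2 / 2 + K / ((2 - beta) * (3 - beta)) * Rpower x (3 - beta))).
      { exists 1; split; [lra|]; intros x Hx; unfold G0; field; lra. }
      apply (right_limit_comb (fun x => K * x ^ 2 / 2)); [|apply right_limit_Rpower; lra].
      apply (right_limit_ext (fun x => 0 * x + K * (x ^ 2 / 2))).
      { exists 1; split; [lra|]; intros x Hx; field. }
      apply (triple_quadratic 1 0 K).
    * apply (right_limit_dominated G1); [exists 1; split; [lra|]; intros x Hx; apply Bh1; lra|].
      replace 0 with (0 + K / (2 - beta) * 0) by ring.
      apply (right_limit_ext (fun x => (0 + K * x) + K / (2 - beta) * Rpower x (2 - beta))).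
      { exists 1; split; [lra|]; intros x Hx; unfold G1; field; lra. }
      apply (right_limit_comb (fun x => 0 + K * x)); [|apply right_limit_Rpower; lra].
      apply (triple_quadratic 1 0 K).
Qed.

(** The maximum principle is applied to the slope: [h1'' = - f <= 0], so [h1] is concave, with
    nonnegative values at both ends. Then [h0] increases from 0. *)
Lemma triple_nonneg (f h0 h1 h2 : R -> R) (b theta : R) :
  triple f b theta h0 h1 h2 -> (forall x, 0 < x < b -> 0 <= f x) ->
  0 <= theta -> 0 <= h1 b ->
  forall x, 0 < x <= b -> 0 <= h1 x /\ 0 <= h0 x.
Proof.
intros [D [L0 L1]] Hf Ht Hb.
assert (H1 : forall x, 0 < x <= b -> 0 <= h1 x).
{ apply (concave_nonneg h1 h2 (fun x => - f x) b theta); auto; intros x Hx.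
  - now apply D.
  - now apply D.
  - specialize (Hf x Hx); lra. }
intros x Hx; split; [now apply H1|].
apply (right_limit_le_incr h0 h1 b); auto.
- intros z Hz; now apply D.
- intros z Hz; apply H1; lra.
Qed.

(** The barrier [theta * (x - x ^ 2 / 2)] has zero right hand side and the same data at 0 and at 1.
    On [(0, 1]] it is at least [theta * x / 2]. *)
Lemma triple_linear_lower (f h0 h1 h2 : R -> R) (theta : R) :
  triple f 1 theta h0 h1 h2 -> (forall x, 0 < x < 1 -> 0 <= f x) ->
  h1 1 = 0 -> 
  forall x, 0 < x <= 1 -> theta * (x - x ^ 2 / 2) <= h0 x.
Proof.
intros T Hf H1 x Hx.
assert (T' := triple_comb _ _ _ _ _ _ _ _ _ _ _ (-1) T (triple_quadratic 1 theta (- theta))).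
assert (N := triple_nonneg _ _ _ _ _ _ T').
cbv beta in N.
assert (N' : 0 <= h0 x + -1 * (theta * x + - theta * (x ^ 2 / 2))).
{ apply N; try lra; intros z Hz; specialize (Hf z Hz); lra. }
lra.
Qed.

(** On [(0, x0]] the barrier is [k * x ^ 2 / 2], whose slope equals [h1 x0] at [x0]; beyond [x0] it
    is enough that [h0] is nondecreasing. *)
Lemma triple_quadratic_lower (f h0 h1 h2 : R -> R) (theta x0 : R) :
  triple f 1 theta h0 h1 h2 -> (forall x, 0 < x < 1 -> 0 <= f x) ->
  0 <= theta -> h1 1 = 0 -> 0 < x0 <= 1 -> 0 < h1 x0 ->
  exists c, 0 < c /\ forall x, 0 < x <= 1 -> c * x ^ 2 <= h0 x.
Proof.
intros T Hf Ht H1 Hx0 Hp.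
set (k := h1 x0 / x0).
assert (Hk : 0 < k) by (apply Rdiv_lt_0_compat; lra).
assert (T0 : triple f x0 theta h0 h1 h2).
{ destruct T as [D L]; split; [|exact L]; intros x Hx; apply D; lra. }
assert (T' := triple_comb _ _ _ _ _ _ _ _ _ _ _ (-1) T0 (triple_quadratic x0 0 k)).
assert (N := triple_nonneg _ _ _ _ _ _ T').
cbv beta in N.
assert (N' : forall x, 0 < x <= x0 -> k * (x ^ 2 / 2) <= h0 x).
{ intros x Hx.
  assert (0 <= h0 x + -1 * (0 * x + k * (x ^ 2 / 2))); [|lra].
  apply N; try lra.
  - intros z Hz; specialize (Hf z ltac:(lra)); lra.
  - replace (k * x0) with (h1 x0) by (unfold k; field; lra); lra. }
assert (Hi : forall x, x0 <= x <= 1 -> h0 x0 <= h0 x).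
{ intros x Hx; apply derive_nonneg_incr with h1; [lra| |].
  - intros z Hz; apply T; lra.
  - intros z Hz; apply (triple_nonneg f h0 h1 h2 1 theta); auto; lra. }
(* The value of the barrier at [x0]: since [x <= 1] and [x0 <= 1], it is a valid coefficient on both
   sides of [x0]. *)
exists (k * x0 ^ 2 / 2); split; [assert (0 < x0 ^ 2) by nra; nra|].
intros x Hx.
assert (k * x0 ^ 2 <= k) by (assert (x0 ^ 2 <= 1) by nra; nra).
destruct (Rle_lt_dec x x0) as [Hxx|Hxx].
- apply Rle_trans with (k * (x ^ 2 / 2)); [|apply N'; lra].
  assert (0 <= (k - k * x0 ^ 2) * x ^ 2) by (apply Rmult_le_pos; nra); lra.
- apply Rle_trans with (h0 x0); [|apply Hi; lra].
  apply Rle_trans with (k * (x0 ^ 2 / 2)); [|apply N'; lra].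
  assert (0 <= k * x0 ^ 2 * (1 - x ^ 2)) by (apply Rmult_le_pos; nra); lra.
Qed.

(** With [gamma < 1] the right hand side is integrable up to 0, so [h2] is bounded above by some
    [M]; two integrations from 0 give the quadratic bound. *)
Lemma triple_upper (f h0 h1 h2 : R -> R) (theta C gamma : R) :
  triple f 1 theta h0 h1 h2 -> gamma < 1 ->
  (forall x, 0 < x < 1 -> Rabs (f x) <= C * Rpower x (- gamma)) ->
  exists M, 0 <= M /\ forall x, 0 < x <= 1 -> h0 x <= theta * x + M * x ^ 2.
Proof.
intros [D [L0 L1]] Hg Bf.
set (K := C / (1 - gamma)).
set (M := Rabs (h2 1) + Rabs K).
assert (HM : 0 <= M) by (pose proof (Rabs_pos (h2 1)); pose proof (Rabs_pos K); unfold M; lra).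
assert (Bh2 : forall x, 0 < x <= 1 -> h2 x <= M).
{ intros x Hx.
  assert (I : Rabs (h2 1 - h2 x) <= K * Rpower 1 (1 - gamma) - K * Rpower x (1 - gamma)).
  { apply (increment_dominated h2 (fun z => K * Rpower z (1 - gamma)) (fun z => - f z)
             (fun z => C * Rpower z (- gamma))); [lra| | |].
    - intros z Hz; apply D; lra.
    - intros z Hz.
      replace (C * Rpower z (- gamma)) with (K * ((1 - gamma) * Rpower z (1 - gamma - 1))).
      + apply is_derive_scal, is_derive_power; lra.
      + replace (1 - gamma - 1) with (- gamma) by ring; unfold K; field; lra.
    - intros z Hz; rewrite Rabs_Ropp; apply Bf; lra. }
  assert (H1 : Rpower 1 (1 - gamma) = 1) by (unfold Rpower; rewrite ln_1, Rmult_0_r; apply exp_0).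
  assert (Hp : Rpower x (1 - gamma) <= 1).
  { apply Rle_trans with (Rpower 1 (1 - gamma)); [apply Rle_Rpower_l; lra|lra]. }
  assert (Hp0 := Rpower_pos x (1 - gamma)).
  rewrite H1 in I.
  assert (K * 1 - K * Rpower x (1 - gamma) <= Rabs K).
  { replace (K * 1 - K * Rpower x (1 - gamma)) with (K * (1 - Rpower x (1 - gamma))) by ring.
    apply Rle_trans with (Rabs K * (1 - Rpower x (1 - gamma))).
    - apply Rmult_le_compat_r; [lra|apply Rle_abs].
    - pose proof (Rabs_pos K); nra. }
  apply Rabs_le_between in I; pose proof (Rle_abs (h2 1)); unfold M; lra. }
assert (Bh1 : forall x, 0 < x <= 1 -> h1 x <= theta + M * x).
{ intros x Hx.
  assert (- theta + theta <= - h1 x + (theta + M * x)); [|lra].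
  apply (right_limit_le_incr (fun z => - h1 z + (theta + M * z))
           (fun z => - h2 z + M) 1); [| | |lra].
  - intros z Hz; apply (is_derive_plus (fun z => - h1 z) (fun z => theta + M * z)).
    + apply (is_derive_opp h1); apply D; lra.
    + apply (triple_quadratic 1 theta M); lra.
  - intros z Hz; specialize (Bh2 z ltac:(lra)); lra.
  - replace (- theta + theta) with (theta + -1 * theta) by ring.
    apply (right_limit_ext (fun z => (theta + M * z) + -1 * h1 z)).
    { exists 1; split; [lra|intros; ring]. }
    apply right_limit_comb; [|exact L1]; apply (triple_quadratic 1 theta M). }
exists M; split; [exact HM|]; intros x Hx.
assert (0 <= - h0 x + (theta * x + M * (x ^ 2 / 2))); [|nra].
apply (right_limit_le_incr (fun z => - h0 z + (theta * z + M * (z ^ 2 / 2)))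
         (fun z => - h1 z + (theta + M * z)) 1); [| | |lra].
- intros z Hz; apply (is_derive_plus (fun z => - h0 z) (fun z => theta * z + M * (z ^ 2 / 2))).
  + apply (is_derive_opp h0); apply D; lra.
  + apply (triple_quadratic 1 theta M); lra.
- intros z Hz; specialize (Bh1 z ltac:(lra)); lra.
- replace 0 with (0 + -1 * 0) by ring.
  apply (right_limit_ext (fun z => (theta * z + M * (z ^ 2 / 2)) + -1 * h0 z)).
  { exists 1; split; [lra|intros; ring]. }
  apply right_limit_comb; [|exact L0]; apply (triple_quadratic 1 theta M).
Qed.

(** * Uniqueness *)

Lemma triple_h2_decr (f h0 h1 h2 : R -> R) (b theta : R) :
  triple f b theta h0 h1 h2 -> (forall x, 0 < x < b -> 0 <= f x) ->
  forall x y, 0 < x <= y -> y <= b -> h2 y <= h2 x.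
Proof.
intros [D _] Hf x y Hx Hy.
assert (- h2 x <= - h2 y); [|lra].
apply (derive_nonneg_incr (fun z => - h2 z) (fun z => - - f z)); [lra| |].
- intros z Hz; apply (is_derive_opp h2); apply D; lra.
- intros z Hz; specialize (Hf z ltac:(lra)); lra.
Qed.

(** As [h2] is nonincreasing, [x * h2 x] lies between [h1 (2 * x) - h1 x] and
    [2 * (h1 x - h1 (x / 2))], and both tend to 0 because [h1] has a limit. This controls the energy
    at 0 when [h2] is unbounded. *)
Lemma triple_h2_limit (f h0 h1 h2 : R -> R) (theta : R) :
  triple f 1 theta h0 h1 h2 -> (forall x, 0 < x < 1 -> 0 <= f x) ->
  right_limit (fun x => x * h2 x) 0.
Proof.
intros T Hf eps He.
pose proof (triple_h2_decr _ _ _ _ _ _ T Hf) as Dec.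
destruct T as [D [_ L1]].
destruct (L1 (eps / 4)) as [d [Hd HL]]; [lra|].
exists (Rmin d 1 / 2); split; [assert (0 < Rmin d 1) by (apply Rmin_pos; lra); lra|].
intros x Hx; pose proof (Rmin_l d 1); pose proof (Rmin_r d 1).
pose proof (HL x ltac:(lra)) as B1; pose proof (HL (x / 2) ltac:(lra)) as B2;
  pose proof (HL (2 * x) ltac:(lra)) as B3.
apply Rabs_def2 in B1; apply Rabs_def2 in B2; apply Rabs_def2 in B3.
destruct (mean_value h1 h2 x (2 * x)) as [c [Hc Ec]]; [lra|intros; apply D; lra|].
destruct (mean_value h1 h2 (x / 2) x) as [e [He' Ee]]; [lra|intros; apply D; lra|].
pose proof (Dec x c ltac:(lra) ltac:(lra)); pose proof (Dec e x ltac:(lra) ltac:(lra)).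
assert (h2 c * x <= h2 x * x) by (apply Rmult_le_compat_r; lra).
assert (h2 x * x <= h2 e * x) by (apply Rmult_le_compat_r; lra).
rewrite Rminus_0_r; apply Rabs_def1; lra.
Qed.

(** The orbit continued down to [x = 0]. It does not mention [delta], so one profile serves every
    [delta < 1]. *)
Definition profile (n theta : R) (h0 h1 h2 : R -> R) : Prop :=
  triple (fun x => (1 - x) * Rpower (h0 x) (1 - n)) 1 theta h0 h1 h2 /\
  (forall x, 0 < x <= 1 -> 0 < h0 x) /\ h1 1 = 0.

Lemma profile_rhs_nonneg (n : R) (h0 : R -> R) (x : R) :
  0 < x < 1 -> 0 <= (1 - x) * Rpower (h0 x) (1 - n).
Proof. intros Hx; pose proof (Rpower_pos (h0 x) (1 - n)); nra. Qed.

Lemma Rpower_decr (x y a : R) : a <= 0 -> 0 < x <= y -> Rpower y a <= Rpower x a.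
Proof.
intros Ha Hx; replace a with (- - a) by ring; rewrite !(Rpower_Ropp _ (- a)).
apply Rinv_le_contravar; [apply Rpower_pos|apply Rle_Rpower_l; lra].
Qed.

(* With [W = h - g], the energy [W W'' - W'^2 / 2] is nondecreasing and vanishes
   at 0, because [W W''' >= 0] when the power [1 - n] is nonpositive.  Hence
   [W W'' >= 0], so [W^2] is convex; its derivative vanishes at 1, and so
   [W^2] is nonincreasing from the value 0. *)
Lemma profile_unique_decreasing (n theta : R) (h0 h1 h2 g0 g1 g2 : R -> R) :
  1 <= n -> profile n theta h0 h1 h2 -> profile n theta g0 g1 g2 ->
  forall x, 0 < x <= 1 -> h0 x = g0 x.
Proof.
intros Hn [Th [Ph Eh]] [Tg [Pg Eg]].
pose proof (triple_h2_limit _ _ _ _ _ Th (profile_rhs_nonneg n h0)) as Lh.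
pose proof (triple_h2_limit _ _ _ _ _ Tg (profile_rhs_nonneg n g0)) as Lg.
destruct (triple_comb _ _ _ _ _ _ _ _ _ _ _ (-1) Th Tg) as [D [L0 L1]].
cbv beta in D.
set (F := fun x => (1 - x) * Rpower (h0 x) (1 - n) + -1 * ((1 - x) * Rpower (g0 x) (1 - n))) in *.
set (W0 := fun x => h0 x + -1 * g0 x) in *.
set (W1 := fun x => h1 x + -1 * g1 x) in *.
set (W2 := fun x => h2 x + -1 * g2 x) in *.
change (forall x, 0 < x <= 1 ->
  is_derive W0 x (W1 x) /\ is_derive W1 x (W2 x) /\ is_derive W2 x (- F x)) in D.
assert (LW : right_limit (fun x => x * W2 x) 0).
{ replace 0 with (0 + -1 * 0) by ring.
  eapply right_limit_ext; [|apply right_limit_comb; [exact Lh|exact Lg]].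
  exists 1; split; [lra|]; intros; unfold W2; ring. }
replace (theta + -1 * theta) with 0 in L1 by ring.
assert (HWF : forall x, 0 < x < 1 -> 0 <= - (W0 x * F x)).
{ intros x Hx.
  specialize (Ph x ltac:(lra)); specialize (Pg x ltac:(lra)).
  unfold W0, F.
  replace (- ((h0 x + -1 * g0 x) *
    ((1 - x) * Rpower (h0 x) (1 - n) + -1 * ((1 - x) * Rpower (g0 x) (1 - n)))))
    with ((1 - x) * ((h0 x - g0 x) * (Rpower (g0 x) (1 - n) - Rpower (h0 x) (1 - n)))) by ring.
  apply Rmult_le_pos; [lra|].
  destruct (Rle_lt_dec (g0 x) (h0 x)) as [Hc|Hc].
  - assert (Rpower (h0 x) (1 - n) <= Rpower (g0 x) (1 - n)) by (apply Rpower_decr; lra).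
    apply Rmult_le_pos; lra.
  - assert (Rpower (g0 x) (1 - n) <= Rpower (h0 x) (1 - n)) by (apply Rpower_decr; lra).
    nra. }
set (E := fun x => W0 x * W2 x - W1 x ^ 2 / 2).
assert (DE : forall x, 0 < x <= 1 -> is_derive E x (- (W0 x * F x))).
{ intros x Hx; destruct (D x Hx) as [D0 [D1 D2]]; unfold E.
  pose proof (is_derive_mult W0 W2 x _ _ D0 D2 Rmult_comm) as M1.
  pose proof (is_derive_mult W1 W1 x _ _ D1 D1 Rmult_comm) as M2.
  pose proof (is_derive_plus _ _ x _ _ M1 (is_derive_scal _ x (- / 2) _ M2)) as M3.
  match type of M3 with is_derive ?u _ ?l =>
    apply (is_derive_ext u); [intros t|replace (- (W0 x * F x)) with l; [exact M3|]] end;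
    unfold plus, mult; simpl; unfold mult; simpl;
    lazymatch goal with |- @eq _ ?u ?v => change (@eq R u v) end; field. }
(* Near 0 the slope [W1] is below 1 in absolute value, hence [Rabs (W0 x) <= x]. Since [x * W2 x]
   tends to 0, so does the term [W0 * W2] of the energy, even if [W2] is unbounded. The factor [s]
   treats both signs at once. *)
assert (BW0 : exists d, 0 < d <= 1 /\ forall x, 0 < x < d -> Rabs (W0 x) <= x).
{ destruct (L1 1) as [d [Hd Hd1]]; [lra|].
  exists (Rmin d 1); split; [split; [apply Rmin_pos; lra|apply Rmin_r]|]; intros x Hx.
  pose proof (Rmin_l d 1); pose proof (Rmin_r d 1).
  assert (C : forall s, Rabs s = 1 -> 0 <= x + s * W0 x).
  { intros s Hs.
    apply (right_limit_le_incr (fun z => z + s * W0 z) (fun z => 1 + s * W1 z) x); [| | |lra].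
    - intros z Hz; apply (is_derive_plus (fun t => t) (fun t => s * W0 t)).
      + apply (is_derive_id (K := R_AbsRing)).
      + apply is_derive_scal; apply D; lra.
    - intros z Hz; specialize (Hd1 z ltac:(lra)); rewrite Rminus_0_r in Hd1.
      assert (B : Rabs (s * W1 z) < 1) by (rewrite Rabs_mult, Hs; lra).
      apply Rabs_def2 in B; lra.
    - replace 0 with (0 + s * (0 + -1 * 0)) by ring.
      apply (right_limit_comb (fun z => z) W0); [apply right_limit_id|].
      replace (0 + -1 * 0) with 0 by ring; exact L0. }
  pose proof (C 1 Rabs_R1); pose proof (C (-1) ltac:(rewrite Rabs_left; lra)).
  apply Rabs_le; lra. }
destruct BW0 as [d0 [Hd0 BW0]].
assert (LE : right_limit E 0).
{ intros eps He.
  destruct (LW (eps / 2)) as [d1 [Hd1 B1]]; [lra|].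
  destruct (L1 (Rmin 1 (eps / 2))) as [d2 [Hd2 B2]]; [apply Rmin_pos; lra|].
  set (d := Rmin d0 (Rmin d1 d2)).
  assert (d <= d0) by apply Rmin_l.
  assert (d <= d1) by (eapply Rle_trans; [apply Rmin_r|apply Rmin_l]).
  assert (d <= d2) by (eapply Rle_trans; [apply Rmin_r|apply Rmin_r]).
  exists d; split; [apply Rmin_pos; [apply Hd0|now apply Rmin_pos]|]; intros x Hx.
  specialize (B1 x ltac:(lra)); specialize (B2 x ltac:(lra)).
  pose proof (BW0 x ltac:(lra)) as B3.
  rewrite !Rminus_0_r in *; unfold E.
  assert (Rabs (W0 x * W2 x) < eps / 2).
  { eapply Rle_lt_trans; [|exact B1]; rewrite !Rabs_mult.
    rewrite (Rabs_pos_eq x) by lra.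
    apply Rmult_le_compat_r; [apply Rabs_pos|exact B3]. }
  assert (Rabs (W1 x ^ 2 / 2) < eps / 2).
  { rewrite Rabs_pos_eq by (pose proof (pow2_ge_0 (W1 x)); lra).
    pose proof (Rmin_l 1 (eps / 2)); pose proof (Rmin_r 1 (eps / 2)).
    rewrite <- (pow2_abs (W1 x)); pose proof (Rabs_pos (W1 x)); nra. }
  unfold Rminus; eapply Rle_lt_trans; [apply Rabs_triang|]; rewrite Rabs_Ropp; lra. }
assert (PE : forall x, 0 < x <= 1 -> 0 <= E x).
{ apply (right_limit_le_incr E (fun x => - (W0 x * F x))); auto. }
assert (HW : forall x, 0 < x <= 1 -> W0 x * W1 x <= 0).
{ intros x Hx.
  replace 0 with (W0 1 * W1 1) by (unfold W1; rewrite Eh, Eg; ring).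
  apply (derive_nonneg_incr (fun z => W0 z * W1 z) (fun z => W1 z * W1 z + W0 z * W2 z)); [lra| |].
  - intros z Hz; destruct (D z ltac:(lra)) as [D0 [D1 _]].
    apply (is_derive_mult W0 W1 z (W1 z) (W2 z) D0 D1 Rmult_comm).
  - intros z Hz; specialize (PE z ltac:(lra)); unfold E in PE; nra. }
intros x Hx.
assert (Z : 0 <= - (W0 x * W0 x)).
{ apply (right_limit_le_incr (fun z => - (W0 z * W0 z))
           (fun z => - (W1 z * W0 z + W0 z * W1 z)) 1); [| | |lra].
  - intros z Hz; destruct (D z ltac:(lra)) as [D0 _].
    apply (is_derive_opp (fun t => W0 t * W0 t)).
    apply (is_derive_mult W0 W0 z (W1 z) (W1 z) D0 D0 Rmult_comm).
  - intros z Hz; specialize (HW z ltac:(lra)); lra.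
  - apply (right_limit_dominated (fun z => z)); [|apply right_limit_id].
    exists d0; split; [apply Hd0|]; intros z Hz; pose proof (BW0 z Hz) as B.
    rewrite Rabs_Ropp, Rabs_mult; pose proof (Rabs_pos (W0 z)); nra. }
assert (Z' : W0 x * W0 x = 0) by (pose proof (Rle_0_sqr (W0 x)) as S; unfold Rsqr in S; lra).
apply Rmult_integral in Z'; unfold W0 in Z'; destruct Z'; lra.
Qed.

(** The slope is positive somewhere, for otherwise [h0], starting from 0, could not become
    positive. *)
Lemma profile_lower (n theta : R) (h0 h1 h2 : R -> R) :
  0 <= theta -> profile n theta h0 h1 h2 ->
  exists c, 0 < c /\ forall x, 0 < x <= 1 -> c * x ^ 2 <= h0 x.
Proof.
intros Ht [T [P E]].
destruct (classic (exists x, 0 < x <= 1 /\ 0 < h1 x)) as [[x0 [Hx0 H]]|Hn].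
- now apply (triple_quadratic_lower _ _ _ _ _ _ T (profile_rhs_nonneg n h0) Ht E Hx0).
- exfalso.
  assert (0 <= - h0 1); [|specialize (P 1 ltac:(lra)); lra].
  apply (right_limit_le_incr (fun z => - h0 z) (fun z => - h1 z) 1); [| | |lra].
  + intros z Hz; apply (is_derive_opp h0); apply T; lra.
  + intros z Hz; destruct (Rle_lt_dec (h1 z) 0); [lra|].
    exfalso; apply Hn; exists z; lra.
  + destruct T as [_ [L0 _]]; intros eps He; destruct (L0 eps He) as [d [Hd L]].
    exists d; split; [exact Hd|]; intros z Hz; specialize (L z Hz).
    rewrite Rminus_0_r in *; now rewrite Rabs_Ropp.
Qed.

(** The maximum principle applied to [k0 - h0 / l]: its right hand side [g - f / l] is nonnegative,
    its slope at 0 is [theta * (1 - / l)], nonnegative because [1 <= l], and its slope at 1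
    vanishes. *)
Lemma triple_comparison (f g h0 h1 h2 k0 k1 k2 : R -> R) (theta l : R) :
  triple f 1 theta h0 h1 h2 -> triple g 1 theta k0 k1 k2 ->
  0 <= theta -> h1 1 = 0 -> k1 1 = 0 -> 1 <= l ->
  (forall x, 0 < x < 1 -> f x <= l * g x) ->
  forall x, 0 < x <= 1 -> h0 x <= l * k0 x.
Proof.
intros Th Tk Ht Eh Ek Hl Hfg x Hx.
pose proof (triple_comb _ _ _ _ _ _ _ _ _ _ _ (- / l) Tk Th) as T.
assert (Hli0 : 0 < / l) by (apply Rinv_0_lt_compat; lra).
assert (Hli : / l <= 1) by (rewrite <- Rinv_1; apply Rinv_le_contravar; lra).
assert (0 <= k0 x + - / l * h0 x).
{ eapply (triple_nonneg _ _ _ _ _ _ T); try lra.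
  - intros z Hz; specialize (Hfg z Hz).
    assert (/ l * f z <= g z); [|lra].
    apply (Rmult_le_reg_l l); [lra|].
    rewrite <- Rmult_assoc, Rinv_r, Rmult_1_l; lra.
  - nra.
  - rewrite Eh, Ek; lra. }
apply (Rmult_le_reg_l (/ l)); [exact Hli0|].
rewrite <- Rmult_assoc, Rinv_l; lra.
Qed.

(** The ratio is written [exp mu], so that raising it to the power [1 - n] multiplies [mu] by
    [1 - n]. *)
Lemma profile_comparison (n theta mu : R) (h0 h1 h2 g0 g1 g2 : R -> R) :
  n <= 1 -> 0 <= theta -> profile n theta h0 h1 h2 -> profile n theta g0 g1 g2 ->
  0 <= mu ->
  (forall x, 0 < x <= 1 -> h0 x <= exp mu * g0 x) ->
  forall x, 0 < x <= 1 -> h0 x <= exp ((1 - n) * mu) * g0 x.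
Proof.
intros Hn Ht [Th [Ph Eh]] [Tg [Pg Eg]] Hmu Hc.
apply (triple_comparison _ _ _ _ _ _ _ _ theta _ Th Tg Ht Eh Eg).
- pose proof (exp_ineq1_le ((1 - n) * mu)); nra.
- intros z Hz; specialize (Hc z ltac:(lra)).
  specialize (Ph z ltac:(lra)); specialize (Pg z ltac:(lra)).
  assert (Rpower (h0 z) (1 - n) <= exp ((1 - n) * mu) * Rpower (g0 z) (1 - n)).
  { apply Rle_trans with (Rpower (exp mu * g0 z) (1 - n)).
    - apply Rle_Rpower_l; lra.
    - rewrite <- Rpower_mult_distr; [|apply exp_pos|lra].
      right; f_equal; unfold Rpower; rewrite ln_exp; reflexivity. }
  nra.
Qed.

(** The iteration must start from a finite ratio. Near 0 any two profiles are comparable: the upper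
    bound [theta * x + M * x ^ 2] of one is absorbed by the linear and the quadratic lower bounds of
    the other. *)
Lemma profile_le (n theta : R) (h0 h1 h2 g0 g1 g2 : R -> R) :
  0 < n < 1 -> 0 <= theta -> profile n theta h0 h1 h2 -> profile n theta g0 g1 g2 ->
  forall x, 0 < x <= 1 -> h0 x <= g0 x.
Proof.
intros Hn Ht Hh Hg.
assert (R0 : exists mu, 0 <= mu /\ forall x, 0 < x <= 1 -> h0 x <= exp mu * g0 x).
{ assert (U : exists M, 0 <= M /\ forall x, 0 < x <= 1 -> h0 x <= theta * x + M * x ^ 2).
  { destruct Hh as [T [P E]].
    assert (B : forall x, 0 < x <= 1 -> h0 x <= h0 1).
    { intros x Hx; apply derive_nonneg_incr with h1; [lra| |].
      - intros z Hz; apply T; lra.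
      - intros z Hz.
        apply (triple_nonneg _ _ _ _ _ _ T (profile_rhs_nonneg n h0)); lra. }
    (* For [n < 1] and [h0] bounded by [h0 1] the right hand side is bounded, hence the exponent
       [gamma = 0]. *)
    apply (triple_upper _ _ _ _ _ (Rpower (h0 1) (1 - n)) 0 T); [lra|].
    intros x Hx; rewrite Ropp_0, Rpower_O, Rmult_1_r by lra.
    rewrite Rabs_pos_eq by (now apply profile_rhs_nonneg).
    assert (Rpower (h0 x) (1 - n) <= Rpower (h0 1) (1 - n)).
    { apply Rle_Rpower_l; [lra|split; [apply P|apply B]; lra]. }
    pose proof (Rpower_pos (h0 x) (1 - n)); nra. }
  destruct U as [M [HM U]].
  assert (Lo : exists K, 1 <= K /\ forall x, 0 < x <= 1 -> theta * x + M * x ^ 2 <= K * g0 x).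
  { destruct (profile_lower _ _ _ _ _ Ht Hg) as [c [Hc Lc]].
    exists (2 + M / c + 1); split.
    { assert (0 <= M / c) by (apply Rcomplements.Rdiv_le_0_compat; lra); lra. }
    intros x Hx; specialize (Lc x Hx).
    assert (theta * x <= 2 * g0 x).
    { destruct Hg as [T [P E]].
      pose proof (triple_linear_lower _ _ _ _ _ T (profile_rhs_nonneg n g0) E x Hx).
      assert (0 <= theta * (x - x ^ 2)) by (apply Rmult_le_pos; nra); lra. }
    assert (M * x ^ 2 <= M / c * g0 x).
    { replace (M * x ^ 2) with (M / c * (c * x ^ 2)) by (field; lra).
      apply Rmult_le_compat_l; [apply Rcomplements.Rdiv_le_0_compat; lra|lra]. }
    destruct Hg as [_ [P _]]; specialize (P x Hx); lra. }
  destruct Lo as [K [HK Lo]].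
  exists (ln K); split.
  - rewrite <- ln_1; apply ln_le; lra.
  - intros x Hx; rewrite exp_ln by lra.
    eapply Rle_trans; [apply U|apply Lo]; exact Hx. }
destruct R0 as [mu [Hmu R0]].
assert (I : forall k, 0 <= (1 - n) ^ k * mu /\
   forall x, 0 < x <= 1 -> h0 x <= exp ((1 - n) ^ k * mu) * g0 x).
{ induction k as [|k [IH1 IH2]].
  - simpl; rewrite Rmult_1_l; now split.
  - replace ((1 - n) ^ S k * mu) with ((1 - n) * ((1 - n) ^ k * mu)) by (simpl; ring).
    split; [apply Rmult_le_pos; lra|].
    apply (profile_comparison n theta _ h0 h1 h2 g0 g1 g2); auto; lra. }
intros x Hx.
assert (L : is_lim_seq (fun k => exp ((1 - n) ^ k * mu) * g0 x) (exp (0 * mu) * g0 x)).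
{ apply (is_lim_seq_mult' _ (fun _ => g0 x)); [|apply is_lim_seq_const].
  apply (is_lim_seq_continuous exp).
  - apply derivable_continuous_pt, derivable_pt_exp.
  - apply (is_lim_seq_mult' _ (fun _ => mu)); [|apply is_lim_seq_const].
    apply is_lim_seq_geom; rewrite Rabs_pos_eq; lra. }
rewrite Rmult_0_l, exp_0, Rmult_1_l in L.
apply (is_lim_seq_le (fun _ => h0 x) _ (h0 x) (g0 x)) with (2 := is_lim_seq_const _) (3 := L).
intros k; now apply I.
Qed.

Lemma profile_unique (n theta : R) (h0 h1 h2 g0 g1 g2 : R -> R) :
  0 < n -> 0 <= theta -> profile n theta h0 h1 h2 -> profile n theta g0 g1 g2 ->
  forall x, 0 < x <= 1 -> h0 x = g0 x /\ h1 x = g1 x /\ h2 x = g2 x.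
Proof.
intros Hn Ht Hh Hg.
assert (E0 : forall x, 0 < x <= 1 -> h0 x = g0 x).
{ intros x Hx; destruct (Rle_lt_dec 1 n) as [Hn1|Hn1].
  - now apply (profile_unique_decreasing n theta h0 h1 h2 g0 g1 g2).
  - apply Rle_antisym.
    + now apply (profile_le n theta h0 h1 h2 g0 g1 g2).
    + now apply (profile_le n theta g0 g1 g2 h0 h1 h2). }
destruct Hh as [[Dh _] [_ Eh]], Hg as [[Dg _] [_ Eg]].
assert (Hloc : forall x, 0 < x < 1 -> locally x (fun z => 0 < z < 1)).
{ intros x Hx; apply (open_and (fun z => 0 < z) (fun z => z < 1));
    [apply open_gt|apply open_lt|exact Hx]. }
assert (E1 : forall x, 0 < x < 1 -> h1 x = g1 x).
{ intros x Hx.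
  rewrite <- (is_derive_unique h0 x (h1 x)) by (apply Dh; lra).
  rewrite <- (is_derive_unique g0 x (g1 x)) by (apply Dg; lra).
  apply Derive_ext_loc; generalize (Hloc x Hx); apply filter_imp.
  intros z Hz; apply E0; lra. }
assert (E2 : forall x, 0 < x < 1 -> h2 x = g2 x).
{ intros x Hx.
  rewrite <- (is_derive_unique h1 x (h2 x)) by (apply Dh; lra).
  rewrite <- (is_derive_unique g1 x (g2 x)) by (apply Dg; lra).
  apply Derive_ext_loc; generalize (Hloc x Hx); apply filter_imp; exact E1. }
intros x Hx; split; [now apply E0|].
destruct (Rle_lt_dec 1 x) as [H1|H1].
(* At 1 the profiles are known to agree only from the left, so [h2 1 = g2 1] is not read off a
   derivative of [h1]: the difference [h2 - g2] has zero derivative between 1/2 and 1. *)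
- replace x with 1 by lra; split; [lra|].
  destruct (mean_value (fun z => h2 z - g2 z)
    (fun z => - ((1 - z) * Rpower (h0 z) (1 - n)) - - ((1 - z) * Rpower (g0 z) (1 - n)))
    (1 / 2) 1) as [c [Hc Ec]]; [lra| |].
  + intros z Hz; apply (is_derive_minus h2 g2); [apply Dh|apply Dg]; lra.
  + rewrite (E2 (1 / 2)), (E0 c) in Ec by lra; lra.
- split; [apply E1|apply E2]; lra.
Qed.

(** * Existence by contraction *)

(** A space of functions at finite distance from the centre [c] in the sup norm weighted by [w].
    Values at [x <= 0] are left free. *)
Definition admissible (c w A : R -> R) : Prop :=
  (forall x, 0 < x -> continuous A x) /\
  exists M, forall x, 0 < x -> Rabs (A x - c x) <= M * w x.

Lemma continuous_pos_uniform_approx (w A : R -> R) :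
  (forall x, 0 < x -> continuous w x) -> (forall x, 0 < x -> 0 <= w x) ->
  (forall e, 0 < e -> exists B, (forall x, 0 < x -> continuous B x) /\
     forall x, 0 < x -> Rabs (B x - A x) <= e * w x) ->
  forall x, 0 < x -> continuous A x.
Proof.
intros Cw Pw H x Hx; apply filterlim_locally; intros eps.
pose proof (Pw x Hx) as Hw; pose proof (cond_pos eps) as He.
(* Near [x] the weight stays below [w x + 1], so each of the two approximation errors is at most
   [eps / 4]. *)
set (e := eps / (4 * (w x + 1))).
assert (Hee : 0 < e) by (apply Rdiv_lt_0_compat; lra).
destruct (H e Hee) as [B [CB HB]].
assert (L1 : locally x (fun z => 0 < z)) by (apply open_gt, Hx).
pose proof (proj1 (filterlim_locally w (w x)) (Cw x Hx) (mkposreal 1 Rlt_0_1)) as L2.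
assert (He4 : 0 < eps / 4) by lra.
pose proof (proj1 (filterlim_locally B (B x)) (CB x Hx) (mkposreal _ He4)) as L3.
generalize (filter_and _ _ L1 (filter_and _ _ L2 L3)); apply filter_imp.
intros z [Hz [Hz1 Hz2]].
change (Rabs (w z - w x) < 1) in Hz1; change (Rabs (B z - B x) < eps / 4) in Hz2.
change (Rabs (A z - A x) < eps).
apply Rabs_def2 in Hz1.
assert (E : e * (w x + 1) = eps / 4) by (unfold e; field; lra).
pose proof (HB x Hx) as H1; pose proof (HB z Hz) as H2.
assert (e * w x <= e * (w x + 1)) by nra.
assert (e * w z <= e * (w x + 1)) by nra.
apply Rabs_def2 in Hz2; apply Rabs_le_between in H1; apply Rabs_le_between in H2.
apply Rabs_def1; lra.
Qed.

(** The Banach fixed point theorem for a relation [S], since solution operators are only known to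
    exist; choice supplies the iteration. The fixed point is a pair with [S A B] and [A = B] on
    positive reals, because [S] need not respect a change of values elsewhere. *)
Lemma contraction_fixpoint (c w : R -> R) (S : (R -> R) -> (R -> R) -> Prop)
    (kappa : R) (A0 : R -> R) :
  0 <= kappa < 1 ->
  (forall x, 0 < x -> continuous w x) -> (forall x, 0 < x -> 0 <= w x) ->
  admissible c w A0 ->
  (forall A, admissible c w A -> exists B, admissible c w B /\ S A B) ->
  (forall A1 A2 B1 B2 N, admissible c w A1 -> admissible c w A2 ->
     S A1 B1 -> S A2 B2 ->
     (forall x, 0 < x -> Rabs (A1 x - A2 x) <= N * w x) ->
     forall x, 0 < x -> Rabs (B1 x - B2 x) <= kappa * N * w x) ->
  exists A B, admissible c w A /\ S A B /\ forall x, 0 < x -> A x = B x.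
Proof.
intros Hk Cw Pw HA0 Hstep Hcontr.
set (T := {A : R -> R | admissible c w A}).
assert (Hnext : forall A : T, exists B : T, S (proj1_sig A) (proj1_sig B)).
{ intros [A HA]; destruct (Hstep A HA) as [B [HB HS]].
  exists (exist _ B HB); exact HS. }
set (next := fun A : T => proj1_sig (constructive_indefinite_description _ (Hnext A))).
assert (Snext : forall A : T, S (proj1_sig A) (proj1_sig (next A))).
{ intros A; exact (proj2_sig (constructive_indefinite_description _ (Hnext A))). }
set (s := fun k => Nat.iter k next (exist _ A0 HA0 : T)).
set (u := fun k => proj1_sig (s k)).
assert (Su : forall k, S (u k) (u (k + 1)%nat)).
{ intros k; rewrite Nat.add_1_r; apply Snext. }
assert (Au : forall k, admissible c w (u k)) by (intros k; apply (proj2_sig (s k))).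
assert (H0 : exists N, 0 <= N /\ forall x, 0 < x -> Rabs (u 1%nat x - u 0%nat x) <= N * w x).
{ destruct (Au 0%nat) as [_ [M0 B0]], (Au 1%nat) as [_ [M1 B1]].
  exists (Rabs (M0 + M1)); split; [apply Rabs_pos|]; intros x Hx.
  specialize (B0 x Hx); specialize (B1 x Hx); specialize (Pw x Hx).
  apply Rabs_le_between in B0; apply Rabs_le_between in B1.
  apply Rle_trans with ((M0 + M1) * w x).
  - apply Rabs_le; lra.
  - apply Rmult_le_compat_r; [exact Pw|apply Rle_abs]. }
destruct H0 as [N [HN H0]].
assert (H1 : forall k x, 0 < x -> Rabs (u (k + 1)%nat x - u k x) <= kappa ^ k * N * w x).
{ induction k as [|k IH]; intros x Hx.
  - simpl pow; rewrite Rmult_1_l; now apply H0.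
  - replace (kappa ^ Datatypes.S k * N) with (kappa * (kappa ^ k * N)) by (simpl; ring).
    replace (Datatypes.S k) with (k + 1)%nat by lia.
    now apply (Hcontr (u (k + 1)%nat) (u k)). }
(* The geometric sum is kept in closed form, which makes the induction on [j] telescope. *)
assert (H2 : forall j k x, 0 < x ->
  Rabs (u (k + j)%nat x - u k x) <= (kappa ^ k - kappa ^ (k + j)) / (1 - kappa) * N * w x).
{ induction j as [|j IH]; intros k x Hx.
  - rewrite Nat.add_0_r, !Rminus_diag, Rabs_R0; right; field; lra.
  - replace (u (k + Datatypes.S j)%nat x - u k x)
      with ((u (k + j + 1)%nat x - u (k + j)%nat x) + (u (k + j)%nat x - u k x))
      by (replace (k + Datatypes.S j)%nat with (k + j + 1)%nat by lia; ring).
    eapply Rle_trans; [apply Rabs_triang|].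
    pose proof (H1 (k + j)%nat x Hx); pose proof (IH k x Hx).
    replace (kappa ^ (k + Datatypes.S j)) with (kappa * kappa ^ (k + j))
      by (replace (k + Datatypes.S j)%nat with (Datatypes.S (k + j)) by lia; reflexivity).
    replace ((kappa ^ k - kappa * kappa ^ (k + j)) / (1 - kappa) * N * w x)
      with (kappa ^ (k + j) * N * w x + (kappa ^ k - kappa ^ (k + j)) / (1 - kappa) * N * w x)
      by (field; lra).
    lra. }
set (K := N / (1 - kappa)).
assert (HK : 0 <= K) by (apply Rcomplements.Rdiv_le_0_compat; lra).
assert (H3 : forall k m x, (k <= m)%nat -> 0 < x -> Rabs (u m x - u k x) <= kappa ^ k * K * w x).
{ intros k m x Hkm Hx; replace m with (k + (m - k))%nat by lia.
  eapply Rle_trans; [apply H2, Hx|].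
  apply Rmult_le_compat_r; [now apply Pw|].
  unfold K; replace ((kappa ^ k - kappa ^ (k + (m - k))) / (1 - kappa) * N)
    with ((kappa ^ k - kappa ^ (k + (m - k))) * (N / (1 - kappa))) by (field; lra).
  apply Rmult_le_compat_r; [exact HK|].
  assert (0 <= kappa ^ (k + (m - k))) by (apply pow_le; lra); lra. }
assert (Hsmall : forall e, 0 < e -> exists k, kappa ^ k * K <= e).
{ intros e He.
  destruct (pow_lt_1_zero kappa) with (y := e / (K + 1)) as [k Hk'].
  - rewrite Rabs_pos_eq; lra.
  - apply Rdiv_lt_0_compat; lra.
  - exists k; specialize (Hk' k (le_n k)).
    rewrite Rabs_pos_eq in Hk' by (apply pow_le; lra).
    assert (0 <= kappa ^ k) by (apply pow_le; lra).
    apply Rle_trans with (kappa ^ k * (K + 1)); [nra|].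
    apply Rle_trans with (e / (K + 1) * (K + 1)); [nra|right; field; lra]. }
set (A := fun x => real (Lim_seq (fun k => u k x))).
assert (LA : forall x, 0 < x -> is_lim_seq (fun k => u k x) (A x)).
{ intros x Hx; apply Lim_seq_correct', ex_lim_seq_cauchy_corr; intros eps.
  specialize (Pw x Hx).
  destruct (Hsmall (eps / (4 * (w x + 1)))) as [k Hk'].
  { apply Rdiv_lt_0_compat; [apply cond_pos|lra]. }
  assert (kappa ^ k * K * w x <= eps / 4).
  { assert (0 <= kappa ^ k * K) by (apply Rmult_le_pos; [apply pow_le|]; lra).
    apply Rle_trans with (eps / (4 * (w x + 1)) * (w x + 1)); [nra|right; field; lra]. }
  exists k; intros n m Hn Hm.
  pose proof (H3 k n x Hn Hx) as Bn; pose proof (H3 k m x Hm Hx) as Bm.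
  pose proof (cond_pos eps).
  apply Rabs_le_between in Bn; apply Rabs_le_between in Bm; apply Rabs_def1; lra. }
assert (H4 : forall k x, 0 < x -> Rabs (u k x - A x) <= kappa ^ k * K * w x).
{ intros k x Hx; rewrite Rabs_minus_sym.
  assert (L : is_lim_seq (fun j => Rabs (u (j + k)%nat x - u k x)) (Rabs (A x - u k x))).
  { apply (is_lim_seq_abs _ (A x - u k x)), is_lim_seq_minus';
      [|apply is_lim_seq_const].
    apply (is_lim_seq_incr_n (fun j => u j x)), LA, Hx. }
  apply (is_lim_seq_le _ (fun _ => kappa ^ k * K * w x) _ (kappa ^ k * K * w x))
    with (2 := L) (3 := is_lim_seq_const _).
  intros j; apply H3; [lia|exact Hx]. }
assert (AA : admissible c w A).
{ split.
  - apply (continuous_pos_uniform_approx w); auto; intros e He.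
    destruct (Hsmall e He) as [k Hk']; exists (u k); split; [apply Au|].
    intros x Hx; eapply Rle_trans; [now apply H4|].
    apply Rmult_le_compat_r; [now apply Pw|exact Hk'].
  - destruct (Au 0%nat) as [_ [M B]]; exists (M + K); intros x Hx.
    specialize (B x Hx); specialize (H4 0%nat x Hx).
    simpl in H4; rewrite Rmult_1_l in H4.
    apply Rabs_le_between in B; apply Rabs_le_between in H4; apply Rabs_le; lra. }
destruct (Hstep A AA) as [B [AB SB]].
exists A, B; split; [exact AA|split; [exact SB|]]; intros x Hx.
(* [B] is a successor of the limit [A]; comparing it with the successors of [u k] shows that the
   sequence also tends to [B]. *)
assert (LB : is_lim_seq (fun k => u (k + 1)%nat x) (B x)).
{ apply is_lim_seq_spec; intros eps.
  specialize (Pw x Hx).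
  destruct (Hsmall (eps / (4 * (w x + 1)))) as [k Hk'].
  { apply Rdiv_lt_0_compat; [apply cond_pos|lra]. }
  exists k; intros m Hm.
  assert (Bm : Rabs (u (m + 1)%nat x - B x) <= kappa * (kappa ^ m * K) * w x).
  { apply (Hcontr (u m) A); auto. }
  assert (0 <= kappa ^ k) by (apply pow_le; lra).
  assert (0 <= kappa ^ m) by (apply pow_le; lra).
  assert (kappa ^ m <= kappa ^ k).
  { replace m with (k + (m - k))%nat by lia; rewrite pow_add.
    assert (kappa ^ (m - k) <= 1) by (rewrite <- (pow1 (m - k)); apply pow_incr; lra).
    nra. }
  assert (kappa * (kappa ^ m * K) <= eps / (4 * (w x + 1))).
  { apply Rle_trans with (kappa ^ k * K); [|exact Hk'].
    assert (kappa ^ m * K <= kappa ^ k * K) by (apply Rmult_le_compat_r; lra).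
    assert (0 <= kappa ^ m * K) by (apply Rmult_le_pos; lra); nra. }
  pose proof (cond_pos eps).
  eapply Rle_lt_trans; [exact Bm|].
  apply Rle_lt_trans with (eps / (4 * (w x + 1)) * (w x + 1)).
  - apply Rle_trans with (eps / (4 * (w x + 1)) * w x); [apply Rmult_le_compat_r; lra|].
    apply Rmult_le_compat_l; [left; apply Rdiv_lt_0_compat|]; lra.
  - replace (eps / (4 * (w x + 1)) * (w x + 1)) with (eps / 4) by (field; lra); lra. }
apply (is_lim_seq_incr_n (fun k => u k x)) in LB.
apply is_lim_seq_unique in LB.
pose proof (is_lim_seq_unique _ _ (LA x Hx)) as LA'.
rewrite LA' in LB; congruence.
Qed.

Lemma exp_mono (x y : R) : x <= y -> exp x <= exp y.
Proof. intros [H| ->]; [left; now apply exp_increasing|lra]. Qed.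

Lemma Rpower_exponent_decr (s a b : R) : 0 < s <= 1 -> a <= b -> Rpower s b <= Rpower s a.
Proof.
intros Hs Hab; apply exp_mono.
assert (ln s <= 0) by (rewrite <- ln_1; apply ln_le; lra); nra.
Qed.

Lemma continuous_Rmult (f g : R -> R) (x : R) :
  continuous f x -> continuous g x -> continuous (fun z => f z * g z) x.
Proof. apply (continuous_mult (K := R_AbsRing)). Qed.

Lemma continuous_cutoff (x : R) : continuous (fun z => Rmax 0 (1 - z)) x.
Proof.
apply (continuous_ext (fun z => ((1 - z) + Rabs (1 - z)) / 2)).
- intros z; unfold Rmax; destruct (Rle_dec 0 (1 - z)).
  + rewrite Rabs_pos_eq; lra.
  + rewrite Rabs_left; lra.
- apply continuous_Rmult; [|apply continuous_const].
  assert (C : continuous (fun z => 1 - z) x).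
  { apply (continuous_minus (V := R_NormedModule)); [apply continuous_const|apply continuous_id]. }
  apply (continuous_plus (V := R_NormedModule)); [exact C|].
  apply (continuous_comp (fun z => 1 - z) Rabs); [exact C|apply continuous_Rabs].
Qed.

Lemma continuous_Rmin_1 (x : R) : continuous (fun z => Rmin z 1) x.
Proof.
apply (continuous_ext (fun z => 1 - Rmax 0 (1 - z))).
- intros z; unfold Rmax, Rmin; destruct (Rle_dec 0 (1 - z)), (Rle_dec z 1); lra.
- apply (continuous_minus (V := R_NormedModule)); [apply continuous_const|apply continuous_cutoff].
Qed.

Lemma triple_exists_boundary (f : R -> R) (theta C beta : R) :
  1 < beta < 2 -> 0 <= C ->
  (forall x, 0 < x -> continuous f x) ->
  (forall x, 0 < x -> Rabs (f x) <= C * Rpower x (- beta)) ->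
  exists h0 h1 h2, (forall b, triple f b theta h0 h1 h2) /\ h1 1 = 0.
Proof.
intros Hb HC Cf Bf.
destruct (triple_exists f C beta Hb HC Cf Bf) as [h0 [h1 [h2 T]]].
set (a := - h1 1 - theta).
exists (fun x => h0 x + 1 * (theta * x + a * (x ^ 2 / 2))),
  (fun x => h1 x + 1 * (theta + a * x)), (fun x => h2 x + 1 * a); split.
- intros b; apply (triple_ext_rhs (fun x => f x + 1 * 0)); [intros; ring|].
  replace theta with (0 + 1 * theta) at 1 by ring.
  exact (triple_comb _ _ _ _ _ _ _ _ _ _ _ 1 (T b) (triple_quadratic b theta a)).
- unfold a; ring.
Qed.

(** Otherwise the maximum principle forces [h1] to vanish identically. Then [h2] has zeros
    [s < 1 / 2 < t], and [f] vanishes somewhere between them. *)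
Lemma triple_positive_slope (f h0 h1 h2 : R -> R) (theta : R) :
  triple f 1 theta h0 h1 h2 -> (forall x, 0 < x < 1 -> 0 < f x) ->
  0 <= theta -> h1 1 = 0 -> exists x0, 0 < x0 <= 1 /\ 0 < h1 x0.
Proof.
intros T Hf Ht H1.
destruct (classic (exists x, 0 < x <= 1 /\ 0 < h1 x)) as [Hy|Hn]; [exact Hy|exfalso].
assert (Z : forall x, 0 < x <= 1 -> h1 x = 0).
{ intros x Hx; apply Rle_antisym.
  - destruct (Rle_lt_dec (h1 x) 0) as [Hl|Hl]; [exact Hl|].
    exfalso; apply Hn; now exists x.
  - apply (triple_nonneg _ _ _ _ _ _ T); auto; [|lra].
    intros z Hz; left; now apply Hf. }
destruct T as [D _].
destruct (mean_value h1 h2 (1 / 4) (1 / 2)) as [s [Hs Es]]; [lra|intros; apply D; lra|].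
destruct (mean_value h1 h2 (1 / 2) (3 / 4)) as [t [Ht' Et]]; [lra|intros; apply D; lra|].
rewrite !Z in Es by lra; rewrite !Z in Et by lra.
destruct (mean_value h2 (fun z => - f z) s t) as [r [Hr Er]]; [lra|intros; apply D; lra|].
specialize (Hf r ltac:(lra)); nra.
Qed.

(* The unknown is [U = ln H].  Replacing [H] by [lambda H] multiplies the right
   hand side by a power of exponent [1 - n], and the boundary value problem
   preserves order, so the solution map is a contraction with factor
   [|1 - n|] for the distance [sup |U1 - U2|]. *)
Lemma profile_exists_contraction (n theta m : R) :
  0 < n < 2 -> 0 <= theta ->
  (m = 1 /\ 0 < theta) \/ (m = 2 /\ theta = 0) -> -1 < m * (1 - n) ->
  exists h0 h1 h2, profile n theta h0 h1 h2.
Proof.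
intros Hn Ht Hm Hmn.
set (p := 1 - n).
assert (Hp : Rabs p < 1) by (unfold p; apply Rabs_def1; lra).
set (f := fun (A : R -> R) s => Rmax 0 (1 - s) * exp (p * A s)).
(* The centre is the logarithm of the expected leading order [x^m]: [m = 1] for positive slope,
   [m = 2] for [theta = 0]. Functions are frozen beyond 1 by [Rmin x 1]. *)
set (c := fun x => m * ln (Rmin x 1)).
set (S := fun A B : R -> R => exists h0 h1 h2,
  (forall b, triple (f A) b theta h0 h1 h2) /\ h1 1 = 0 /\
  (forall x, 0 < x <= 1 -> 0 < h0 x) /\
  forall x, 0 < x -> B x = ln (h0 (Rmin x 1))).
assert (Hmin : forall x, 0 < x -> 0 < Rmin x 1 <= 1).
{ intros x Hx; split; [apply Rmin_pos; lra|apply Rmin_r]. }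
assert (Cln : forall (h : R -> R) x, 0 < x -> continuous h (Rmin x 1) -> 0 < h (Rmin x 1) ->
   continuous (fun z => ln (h (Rmin z 1))) x).
{ intros h x Hx Ch Hh.
  apply (continuous_comp (fun z => h (Rmin z 1)) ln).
  - apply (continuous_comp (fun z => Rmin z 1) h); [apply continuous_Rmin_1|exact Ch].
  - apply continuity_pt_filterlim, derivable_continuous_pt.
    exists (/ h (Rmin x 1)); now apply derivable_pt_lim_ln. }
assert (Hf0 : forall A s, 0 <= f A s).
{ intros A s; apply Rmult_le_pos; [apply Rmax_l|left; apply exp_pos]. }
assert (Hf1 : forall A s, 0 < s < 1 -> 0 < f A s).
{ intros A s Hs; apply Rmult_lt_0_compat; [|apply exp_pos].
  rewrite Rmax_right; lra. }
destruct (contraction_fixpoint c (fun _ => 1) S (Rabs p) c) as [A [B [AA [SAB EAB]]]].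
- split; [apply Rabs_pos|exact Hp].
- intros; apply continuous_const.
- intros; lra.
- split.
  + intros x Hx; apply continuous_Rmult; [apply continuous_const|].
    apply (Cln (fun z => z)); [exact Hx|apply continuous_id|now apply Hmin].
  + exists 0; intros; rewrite Rminus_diag, Rabs_R0; lra.
- intros A [CA [M0 BA]].
  set (M := Rabs M0).
  (* A bounded distance between [A] and [m * ln x] bounds the right hand side by a multiple of
     [x^(m p)]. The hypothesis on [m * (1 - n)] is the integrability of this power; on [(0, 1]] a
     positive exponent may be lowered to 0. *)
  set (gamma := Rmax 0 (- (m * p))).
  assert (Hg : 0 <= gamma < 1).
  { split; [apply Rmax_l|apply Rmax_lub_lt; unfold p; lra]. }
  assert (Hf2 : forall s, 0 < s <= 1 -> f A s <= exp M * Rpower s (- gamma)).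
  { intros s Hs; specialize (BA s ltac:(lra)); unfold c in BA.
    rewrite Rmin_left, Rmult_1_r in BA by lra.
    apply Rle_trans with (exp (p * A s)).
    { unfold f; rewrite Rmax_right by lra; pose proof (exp_pos (p * A s)); nra. }
    apply Rle_trans with (exp M * Rpower s (m * p)).
    - unfold Rpower; rewrite <- exp_plus; apply exp_mono.
      assert (E : Rabs (p * (A s - m * ln s)) <= M).
      { rewrite Rabs_mult; apply Rle_trans with (1 * Rabs M0); [|unfold M; lra].
        apply Rmult_le_compat; try apply Rabs_pos; [lra|].
        eapply Rle_trans; [exact BA|apply Rle_abs]. }
      apply Rabs_le_between in E; lra.
    - apply Rmult_le_compat_l; [left; apply exp_pos|].
      apply Rpower_exponent_decr; [exact Hs|].
      pose proof (Rmax_r 0 (- (m * p))); unfold gamma; lra. }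
  (* The exponent 3/2 is a choice within [(1, 2)]: it exceeds [gamma], which suffices on
     [(0, 1]]. *)
  destruct (triple_exists_boundary (f A) theta (exp M) (3 / 2)) as [h0 [h1 [h2 [T E1]]]].
  + lra.
  + left; apply exp_pos.
  + intros x Hx; apply continuous_Rmult; [apply continuous_cutoff|].
    apply (continuous_comp (fun z => p * A z) exp).
    * apply continuous_Rmult; [apply continuous_const|now apply CA].
    * apply continuity_pt_filterlim, derivable_continuous_pt, derivable_pt_exp.
  + intros x Hx; rewrite Rabs_pos_eq by apply Hf0.
    destruct (Rle_lt_dec x 1) as [Hx1|Hx1].
    * eapply Rle_trans; [apply Hf2; lra|].
      apply Rmult_le_compat_l; [left; apply exp_pos|].
      apply Rpower_exponent_decr; lra.
    * unfold f; rewrite Rmax_left, Rmult_0_l by lra.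
      apply Rmult_le_pos; left; apply exp_pos.
  + assert (Hfn : forall x, 0 < x < 1 -> 0 <= f A x) by (intros; apply Hf0).
    destruct (triple_positive_slope _ _ _ _ _ (T 1) (Hf1 A) Ht E1) as [x0 [Hx0 Hs]].
    destruct (triple_quadratic_lower _ _ _ _ _ _ (T 1) Hfn Ht E1 Hx0 Hs) as [q [Hq Lq]].
    assert (Ph : forall x, 0 < x <= 1 -> 0 < h0 x).
    { intros x Hx; specialize (Lq x Hx); assert (0 < x ^ 2) by nra; nra. }
    destruct (triple_upper _ _ _ _ _ (exp M) gamma (T 1)) as [K [HK UK]]; [lra| |].
    { intros x Hx; rewrite Rabs_pos_eq by apply Hf0; apply Hf2; lra. }
    (* The solution has exact order [x^m], so its logarithm is again at bounded distance from
       [c]. *)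
    assert (Bd : exists L U, 0 < L /\ 0 < U /\ forall x, 0 < x <= 1 ->
              L * exp (m * ln x) <= h0 x <= U * exp (m * ln x)).
    { destruct Hm as [[-> Hth]|[-> Hth]].
      - exists (theta / 2), (theta + K); split; [lra|split; [lra|]]; intros x Hx.
        rewrite Rmult_1_l, exp_ln by lra; split.
        + pose proof (triple_linear_lower _ _ _ _ _ (T 1) Hfn E1 x Hx).
          assert (0 <= theta * (x - x ^ 2)) by (apply Rmult_le_pos; nra); lra.
        + specialize (UK x Hx); assert (K * x ^ 2 <= K * x) by (apply Rmult_le_compat_l; nra); lra.
      - exists q, (K + 1); split; [lra|split; [lra|]]; intros x Hx.
        replace (exp (2 * ln x)) with (x ^ 2).
        + specialize (UK x Hx); specialize (Lq x Hx); nra.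
        + rewrite <- (Rpower_pow 2 x) by lra; reflexivity. }
    destruct Bd as [L [U [HL [HU Bd]]]].
    exists (fun x => ln (h0 (Rmin x 1))); split; [split|].
    * intros x Hx; apply Cln; [exact Hx| |apply Ph, Hmin, Hx].
      eapply is_derive_continuous; apply (T 1), Hmin, Hx.
    * exists (Rabs (ln L) + Rabs (ln U)); intros x Hx; rewrite Rmult_1_r.
      specialize (Hmin x Hx); specialize (Bd _ Hmin); specialize (Ph _ Hmin).
      pose proof (exp_pos (m * ln (Rmin x 1))).
      assert (ln L + m * ln (Rmin x 1) <= ln (h0 (Rmin x 1))).
      { rewrite <- (ln_exp (m * ln (Rmin x 1))), <- ln_mult by assumption.
        apply ln_le; [apply Rmult_lt_0_compat; assumption|lra]. }
      assert (ln (h0 (Rmin x 1)) <= ln U + m * ln (Rmin x 1)).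
      { rewrite <- (ln_exp (m * ln (Rmin x 1))), <- ln_mult by assumption.
        apply ln_le; [assumption|lra]. }
      pose proof (Rle_abs (ln U)); pose proof (Rabs_pos (ln U)).
      pose proof (Rcomplements.Rabs_maj2 (ln L)); pose proof (Rabs_pos (ln L)).
      unfold c; apply Rabs_le; lra.
    * exists h0, h1, h2; split; [exact T|split; [exact E1|split; [exact Ph|]]].
      intros; reflexivity.
- intros A1 A2 B1 B2 N _ _ S1 S2 HN.
  assert (W : forall A1 A2 B1 B2, S A1 B1 -> S A2 B2 ->
    (forall x, 0 < x -> Rabs (A1 x - A2 x) <= N * 1) ->
    forall x, 0 < x -> B1 x <= Rabs p * N + B2 x).
  { clear - Ht Hmin; intros A1 A2 B1 B2 [h0 [h1 [h2 [Th [Eh [Ph Lh]]]]]]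
      [k0 [k1 [k2 [Tk [Ek [Pk Lk]]]]]] HN x Hx.
    rewrite Lh, Lk by exact Hx.
    rewrite <- (ln_exp (Rabs p * N)), <- ln_mult; [|apply exp_pos|apply Pk, Hmin, Hx].
    apply ln_le; [apply Ph, Hmin, Hx|].
    apply (triple_comparison _ _ _ _ _ _ _ _ _ _ (Th 1) (Tk 1) Ht Eh Ek); [| |apply Hmin, Hx].
    - specialize (HN 1 Rlt_0_1); pose proof (Rabs_pos (A1 1 - A2 1)).
      pose proof (exp_ineq1_le (Rabs p * N)); pose proof (Rabs_pos p).
      assert (0 <= Rabs p * N) by (apply Rmult_le_pos; lra); lra.
    - intros z Hz; unfold f.
      replace (exp (Rabs p * N) * (Rmax 0 (1 - z) * exp (p * A2 z)))
        with (Rmax 0 (1 - z) * exp (Rabs p * N + p * A2 z)) by (rewrite exp_plus; ring).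
      apply Rmult_le_compat_l; [apply Rmax_l|]; apply exp_mono.
      specialize (HN z ltac:(lra)).
      assert (p * (A1 z - A2 z) <= Rabs p * N); [|lra].
      eapply Rle_trans; [apply Rle_abs|]; rewrite Rabs_mult.
      apply Rmult_le_compat_l; [apply Rabs_pos|lra]. }
  intros x Hx.
  pose proof (W A1 A2 B1 B2 S1 S2 HN x Hx).
  assert (HN' : forall z, 0 < z -> Rabs (A2 z - A1 z) <= N * 1).
  { intros z Hz; rewrite Rabs_minus_sym; now apply HN. }
  pose proof (W A2 A1 B2 B1 S2 S1 HN' x Hx).
  apply Rabs_le; lra.
- destruct SAB as [h0 [h1 [h2 [T [E1 [Ph LB]]]]]].
  exists h0, h1, h2; split; [|split; [exact Ph|exact E1]].
  apply (triple_ext_rhs (f A)); [|apply T].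
  intros x Hx; unfold f; rewrite Rmax_right by lra.
  rewrite EAB, LB, Rmin_left by lra; reflexivity.
Qed.

(** * Existence by shooting *)

Lemma dominated_from_zero (F G f g : R -> R) :
  (forall x, 0 < x -> is_derive F x (f x)) ->
  (forall x, 0 < x -> is_derive G x (g x)) ->
  (forall x, 0 < x -> Rabs (f x) <= g x) ->
  (forall x, 0 < x -> 0 <= G x) -> right_limit F 0 ->
  forall x, 0 < x -> Rabs (F x) <= G x.
Proof.
intros DF DG Hfg HG HF x Hx; apply le_epsilon; intros eps He.
destruct (HF eps He) as [d [Hd Hl]].
set (y := Rmin (d / 2) x).
assert (Hy : 0 < y) by (apply Rmin_pos; lra).
assert (y <= d / 2) by apply Rmin_l; assert (y <= x) by apply Rmin_r.
specialize (Hl y ltac:(lra)); rewrite Rminus_0_r in Hl.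
pose proof (HG y Hy).
assert (I : Rabs (F x - F y) <= G x - G y).
{ apply (increment_dominated F G f g); intros; [lra|apply DF|apply DG|apply Hfg]; lra. }
apply Rabs_le_between in I; apply Rabs_def2 in Hl; apply Rabs_le; lra.
Qed.

Lemma Rpower_le_exp (r x a : R) :
  0 < r -> 0 < x -> 0 < a < 1 -> Rpower x a <= Rpower r a * exp (x / r).
Proof.
intros Hr Hx Ha.
assert (Hu : 0 < x / r) by (apply Rdiv_lt_0_compat; lra).
replace (Rpower x a) with (Rpower r a * Rpower (x / r) a).
- apply Rmult_le_compat_l; [left; apply Rpower_pos|]; apply exp_mono.
  pose proof (exp_ineq1_le (ln (x / r))) as H; rewrite exp_ln in H by exact Hu.
  destruct (Rle_lt_dec (ln (x / r)) 0); nra.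
- rewrite Rpower_mult_distr by assumption; f_equal; field; lra.
Qed.

Lemma is_derive_exp_scale (r x : R) :
  0 < r -> is_derive (fun z => exp (z / r)) x (exp (x / r) / r).
Proof. intros Hr; auto_derive; [exact I|unfold Rdiv; ring]. Qed.

(** The gain of the linear problem in the norm with weight [x * exp (x / r)]. The factor
    [beta / (beta - 1)] comes from integrating [f] to [h2], the next one from integrating [h2] to
    [h1]; the power of [r] makes the gain as small as desired. *)
Definition weight_const (beta r : R) : R :=
  beta / (beta - 1) * (exp 1 / (2 - beta) + 1) * Rpower r (2 - beta).

(** The bound on [f] has a power, which matters for [s <= r], and an exponential, which matters for
    [s >= r]. [h2] is estimated from its zero at [r] in both directions, then [h1] and [h0] from 0.
    Each integration of [exp (s / r)] gains a factor [r]. *)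
Lemma triple_weighted_bound (f h0 h1 h2 : R -> R) (beta r K : R) :
  1 < beta < 2 -> 0 < r -> 0 <= K ->
  (forall b, triple f b 0 h0 h1 h2) -> h2 r = 0 ->
  (forall s, 0 < s ->
     Rabs (f s) <= K * (exp 1 * Rpower s (- beta) + Rpower r (- beta) * exp (s / r))) ->
  forall x, 0 < x ->
    Rabs (h1 x) <= K * weight_const beta r * exp (x / r) /\
    Rabs (h0 x) <= K * weight_const beta r * (x * exp (x / r)).
Proof.
intros Hb Hr HK T Hh2 Bf.
set (e := exp 1) in *.
assert (He : 0 < e) by apply exp_pos.
set (c1 := beta / (beta - 1)).
assert (Hc1 : c1 = 1 + / (beta - 1)) by (unfold c1; field; lra).
assert (Hb1 : 0 < / (beta - 1)) by (apply Rinv_0_lt_compat; lra).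
assert (Hrr : Rpower r (1 - beta) = Rpower r (- beta) * r).
{ replace (1 - beta) with (- beta + 1) by ring; rewrite Rpower_plus, Rpower_1; lra. }
assert (Hrr2 : Rpower r (2 - beta) = Rpower r (1 - beta) * r).
{ replace (2 - beta) with (1 - beta + 1) by ring; rewrite Rpower_plus, Rpower_1; lra. }
set (rho := Rpower r (1 - beta)) in *.
assert (Hrho : 0 < rho) by apply Rpower_pos.
assert (D2 : forall x, 0 < x -> is_derive h2 x (- f x)) by (intros x Hx; apply (T x); lra).
assert (D1 : forall x, 0 < x -> is_derive h1 x (h2 x)) by (intros x Hx; apply (T x); lra).
assert (D0 : forall x, 0 < x -> is_derive h0 x (h1 x)) by (intros x Hx; apply (T x); lra).
assert (B2 : forall t, 0 < t ->
          Rabs (h2 t) <= K * c1 * (e * Rpower t (1 - beta) + rho * exp (t / r))).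
{ set (G := fun s => K * (- (e * / (beta - 1)) * Rpower s (1 - beta) + rho * exp (s / r))).
  set (g := fun s => K * (e * Rpower s (- beta) + Rpower r (- beta) * exp (s / r))).
  assert (DG : forall s, 0 < s -> is_derive G s (g s)).
  { intros s Hs; unfold G, g; apply is_derive_scal.
    apply (is_derive_plus (fun z => - (e * / (beta - 1)) * Rpower z (1 - beta))
             (fun z => rho * exp (z / r))).
    - replace (e * Rpower s (- beta))
        with (- (e * / (beta - 1)) * ((1 - beta) * Rpower s (1 - beta - 1))).
      + apply is_derive_scal, is_derive_power, Hs.
      + replace (1 - beta - 1) with (- beta) by ring; field; lra.
    - replace (Rpower r (- beta) * exp (s / r)) with (rho * (exp (s / r) / r)).
      + apply is_derive_scal, is_derive_exp_scale, Hr.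
      + rewrite Hrr; field; lra. }
  assert (I : forall s t, 0 < s <= t -> Rabs (h2 t - h2 s) <= G t - G s).
  { intros s t Hst; apply (increment_dominated h2 G (fun z => - f z) g).
    - lra.
    - intros; apply D2; lra.
    - intros; apply DG; lra.
    - intros; rewrite Rabs_Ropp; apply Bf; lra. }
  assert (Er : exp (r / r) = e) by (unfold e; f_equal; field; lra).
  intros t Ht; rewrite Rmult_assoc.
  pose proof (Rpower_pos t (1 - beta)) as Pt; pose proof (exp_pos (t / r)) as Pe.
  destruct (Rle_lt_dec r t) as [Hrt|Hrt].
  - assert (Hee : e <= exp (t / r)).
    { rewrite <- Er; apply exp_mono, Rmult_le_compat_r; [left; now apply Rinv_0_lt_compat|lra]. }
    specialize (I r t ltac:(lra)); rewrite Hh2, Rminus_0_r in I.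
    eapply Rle_trans; [exact I|]; unfold G; rewrite Er; fold rho.
    rewrite <- Rmult_minus_distr_l; apply Rmult_le_compat_l; [exact HK|].
    rewrite Hc1.
    assert (0 <= / (beta - 1) * rho * (exp (t / r) - e)) by (repeat apply Rmult_le_pos; lra).
    assert (0 <= / (beta - 1) * e * Rpower t (1 - beta)) by (repeat apply Rmult_le_pos; lra).
    assert (0 <= e * Rpower t (1 - beta)) by (apply Rmult_le_pos; lra).
    assert (0 <= rho * e) by (apply Rmult_le_pos; lra).
    lra.
  - assert (Hp : rho <= Rpower t (1 - beta)) by (apply Rpower_decr; lra).
    specialize (I t r ltac:(lra)); rewrite Hh2, Rminus_0_l, Rabs_Ropp in I.
    eapply Rle_trans; [exact I|]; unfold G; rewrite Er; fold rho.
    rewrite <- Rmult_minus_distr_l; apply Rmult_le_compat_l; [exact HK|].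
    rewrite Hc1.
    assert (0 <= / (beta - 1) * rho * e) by (repeat apply Rmult_le_pos; lra).
    assert (0 <= / (beta - 1) * rho * exp (t / r)) by (repeat apply Rmult_le_pos; lra).
    assert (0 <= rho * exp (t / r)) by (apply Rmult_le_pos; lra).
    assert (0 <= e * (Rpower t (1 - beta) - rho)) by (apply Rmult_le_pos; lra).
    lra. }
assert (Hc1p : 0 <= c1) by lra.
assert (HKc : 0 <= K * c1) by (now apply Rmult_le_pos).
assert (Hb2 : 0 < / (2 - beta)) by (apply Rinv_0_lt_compat; lra).
assert (B1 : forall x, 0 < x -> Rabs (h1 x) <= K * weight_const beta r * exp (x / r)).
{ set (G := fun x => K * c1 * (e * / (2 - beta) * Rpower x (2 - beta) + rho * r * exp (x / r))).
  intros x Hx; apply Rle_trans with (G x).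
  - apply (dominated_from_zero h1 G h2
             (fun t => K * c1 * (e * Rpower t (1 - beta) + rho * exp (t / r)))); auto.
    + intros s Hs; unfold G; apply is_derive_scal.
      apply (is_derive_plus (fun z => e * / (2 - beta) * Rpower z (2 - beta))
             (fun z => rho * r * exp (z / r))).
      * replace (e * Rpower s (1 - beta))
          with (e * / (2 - beta) * ((2 - beta) * Rpower s (2 - beta - 1))).
        -- apply is_derive_scal, is_derive_power, Hs.
        -- replace (2 - beta - 1) with (1 - beta) by ring; field; lra.
      * replace (rho * exp (s / r)) with (rho * r * (exp (s / r) / r)) by (field; lra).
        apply is_derive_scal, is_derive_exp_scale, Hr.
    + intros s Hs; unfold G.
      pose proof (Rpower_pos s (2 - beta)); pose proof (exp_pos (s / r)).
      apply Rmult_le_pos; [exact HKc|].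
      apply Rplus_le_le_0_compat; repeat apply Rmult_le_pos; lra.
    + apply (T 1).
  - unfold G, weight_const; rewrite Hrr2; fold rho c1 e.
    assert (L : Rpower x (2 - beta) <= rho * r * exp (x / r)).
    { rewrite <- Hrr2; apply Rpower_le_exp; lra. }
    replace (K * (c1 * (e / (2 - beta) + 1) * (rho * r)) * exp (x / r))
      with (K * c1 * (e * / (2 - beta) * (rho * r * exp (x / r)) + rho * r * exp (x / r)))
      by (field; lra).
    apply Rmult_le_compat_l; [exact HKc|]; apply Rplus_le_compat_r.
    apply Rmult_le_compat_l; [apply Rmult_le_pos; lra|exact L]. }
(* The sign is read off the bound just proved, since an absolute value is nonnegative. *)
assert (HW : 0 <= K * weight_const beta r).
{ pose proof (B1 r Hr) as B; pose proof (Rabs_pos (h1 r)); pose proof (exp_pos (r / r)).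
  destruct (Rle_lt_dec 0 (K * weight_const beta r)) as [Hw|Hw]; [exact Hw|nra]. }
intros x Hx; split; [now apply B1|].
apply (dominated_from_zero h0 (fun x => K * weight_const beta r * (x * exp (x / r))) h1
         (fun x => K * weight_const beta r * (exp (x / r) + x * (exp (x / r) / r)))); auto.
- intros s Hs; apply is_derive_scal; auto_derive; [exact I|unfold Rdiv; ring].
- intros s Hs; eapply Rle_trans; [now apply B1|].
  apply Rmult_le_compat_l; [exact HW|].
  pose proof (exp_pos (s / r)).
  assert (0 <= s * (exp (s / r) / r)).
  { apply Rmult_le_pos; [lra|left; apply Rdiv_lt_0_compat; lra]. }
  lra.
- intros s Hs; apply Rmult_le_pos; [exact HW|].
  apply Rmult_le_pos; [lra|left; apply exp_pos].
- apply (T 1).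
Qed.

Lemma Rpower_lipschitz (m a b p : R) :
  p <= 0 -> 0 < m <= a -> m <= b ->
  Rabs (Rpower a p - Rpower b p) <= - p * Rpower m (p - 1) * Rabs (a - b).
Proof.
intros Hp.
assert (W : forall u v, 0 < m <= u -> u < v ->
          Rabs (Rpower v p - Rpower u p) <= - p * Rpower m (p - 1) * Rabs (v - u)).
{ intros u v Hu Huv.
  destruct (mean_value (fun z => Rpower z p) (fun z => p * Rpower z (p - 1)) u v)
    as [c [Hc ->]]; [exact Huv|intros; apply is_derive_power; lra|].
  rewrite Rabs_mult; apply Rmult_le_compat_r; [apply Rabs_pos|].
  rewrite Rabs_mult, Rabs_left1, (Rabs_pos_eq (Rpower _ _)) by
    (try (left; apply Rpower_pos); lra).
  apply Rmult_le_compat_l; [lra|apply Rpower_decr; lra]. }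
intros Ha Hb; destruct (Rtotal_order a b) as [H|[->|H]].
- rewrite (Rabs_minus_sym a b), Rabs_minus_sym; apply W; lra.
- rewrite !Rminus_diag, Rabs_R0; lra.
- apply W; lra.
Qed.

Lemma Rmax_lipschitz (a b c : R) : Rabs (Rmax a c - Rmax b c) <= Rabs (a - b).
Proof.
unfold Rmax; destruct (Rle_dec a c), (Rle_dec b c);
  unfold Rabs; repeat destruct Rcase_abs; lra.
Qed.

Lemma continuous_Rmax (f g : R -> R) (x : R) :
  continuous f x -> continuous g x -> continuous (fun z => Rmax (f z) (g z)) x.
Proof.
intros Cf Cg.
apply (continuous_ext (fun z => ((f z + g z) + Rabs (f z - g z)) / 2)).
- intros z; unfold Rmax; destruct (Rle_dec (f z) (g z)).
  + rewrite Rabs_left1; lra.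
  + rewrite Rabs_pos_eq; lra.
- apply continuous_Rmult; [|apply continuous_const].
  apply (continuous_plus (V := R_NormedModule)).
  + now apply (continuous_plus (V := R_NormedModule)).
  + apply (continuous_comp (fun z => f z - g z) Rabs); [|apply continuous_Rabs].
    now apply (continuous_minus (V := R_NormedModule)).
Qed.

(** The iteration of [c + N / 2] tends to its fixed point [2 * c] from any finite starting bound
    [M]. It replaces the usual absorption argument without forming a supremum. *)
Lemma halving_bound (P : R -> Prop) (d c M : R) :
  (forall N, P N -> d <= N) -> (forall N, P N -> P (c + N / 2)) -> P M -> d <= 2 * c.
Proof.
intros Hd Hs HM.
assert (I : forall k, P (2 * c + (M - 2 * c) * (1 / 2) ^ k)).
{ induction k as [|k IH].
  - replace (2 * c + (M - 2 * c) * (1 / 2) ^ 0) with M by (simpl; ring); exact HM.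
  - replace (2 * c + (M - 2 * c) * (1 / 2) ^ S k)
      with (c + (2 * c + (M - 2 * c) * (1 / 2) ^ k) / 2) by (simpl; field).
    now apply Hs. }
assert (L : is_lim_seq (fun k => 2 * c + (M - 2 * c) * (1 / 2) ^ k) (2 * c + (M - 2 * c) * 0)).
{ apply is_lim_seq_plus'; [apply is_lim_seq_const|].
  apply is_lim_seq_mult'; [apply is_lim_seq_const|].
  apply is_lim_seq_geom; rewrite Rabs_pos_eq; lra. }
rewrite Rmult_0_r, Rplus_0_r in L.
apply (is_lim_seq_le (fun _ => d) _ d (2 * c)) with (2 := is_lim_seq_const _) (3 := L).
intros k; now apply Hd.
Qed.

Definition truncated_rhs (n theta : R) (A : R -> R) (s : R) : R :=
  Rmax 0 (1 - s) * Rpower (Rmax (A s) (theta * s / 2)) (1 - n).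

Lemma truncated_rhs_nonneg (n theta : R) (A : R -> R) (s : R) :
  0 <= truncated_rhs n theta A s.
Proof. apply Rmult_le_pos; [apply Rmax_l|left; apply Rpower_pos]. Qed.

Lemma truncated_rhs_continuous (n theta : R) (A : R -> R) :
  0 < theta -> (forall x, 0 < x -> continuous A x) ->
  forall x, 0 < x -> continuous (truncated_rhs n theta A) x.
Proof.
intros Ht CA x Hx; apply continuous_Rmult; [apply continuous_cutoff|].
apply (continuous_comp (fun s => Rmax (A s) (theta * s / 2)) (fun z => Rpower z (1 - n))).
- apply continuous_Rmax; [now apply CA|].
  apply (is_derive_continuous _ _ (theta / 2)); auto_derive; [exact I|unfold Rdiv; ring].
- eapply is_derive_continuous, is_derive_power.
  pose proof (Rmax_r (A x) (theta * x / 2)).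
  assert (0 < theta * x) by (apply Rmult_lt_0_compat; lra); lra.
Qed.

(** The true singularity is [s^(1-n)], and [n - 1] need not exceed 1. The exponent [(n + 1) / 2] is
    at least [n - 1] for [n <= 3] and lies in [(1, 2)] exactly for [1 < n < 3]. *)
Lemma truncated_rhs_bound (n theta : R) (A : R -> R) (s : R) :
  1 <= n <= 3 -> 0 < theta -> 0 < s ->
  Rabs (truncated_rhs n theta A s) <=
  Rpower (theta / 2) (1 - n) * Rpower s (- ((n + 1) / 2)).
Proof.
intros Hn Ht Hs; rewrite Rabs_pos_eq by apply truncated_rhs_nonneg; unfold truncated_rhs.
pose proof (Rpower_pos (theta / 2) (1 - n)) as P1.
pose proof (Rpower_pos s (- ((n + 1) / 2))) as P2.
destruct (Rle_lt_dec s 1) as [Hs1|Hs1].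
- rewrite Rmax_right by lra.
  assert (H : Rpower (Rmax (A s) (theta * s / 2)) (1 - n) <=
              Rpower (theta / 2) (1 - n) * Rpower s (- ((n + 1) / 2))).
  { apply Rle_trans with (Rpower (theta / 2 * s) (1 - n)).
    - apply Rpower_decr; [lra|split; [apply Rmult_lt_0_compat; lra|]].
      replace (theta / 2 * s) with (theta * s / 2) by field; apply Rmax_r.
    - rewrite <- Rpower_mult_distr by lra.
      apply Rmult_le_compat_l; [lra|apply Rpower_exponent_decr; lra]. }
  pose proof (Rpower_pos (Rmax (A s) (theta * s / 2)) (1 - n)); nra.
- rewrite Rmax_left, Rmult_0_l by lra; apply Rmult_le_pos; lra.
Qed.

(** The truncation bounds the derivative of the power by a multiple of [s^(-n)], and the factor [s]
    of the weight reduces this to [s^(1-n)]. The product of power and exponential is then split into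
    a sum at [s = r]. *)
Lemma truncated_rhs_lipschitz (n theta r N : R) (A1 A2 : R -> R) (s : R) :
  1 <= n <= 3 -> 0 < theta -> 0 < r -> 0 <= N -> 0 < s ->
  Rabs (A1 s - A2 s) <= N * (s * exp (s / r)) ->
  Rabs (truncated_rhs n theta A1 s - truncated_rhs n theta A2 s) <=
  (n - 1) * Rpower (theta / 2) (- n) * N *
    (exp 1 * Rpower s (- ((n + 1) / 2)) + Rpower r (- ((n + 1) / 2)) * exp (s / r)).
Proof.
intros Hn Ht Hr HN Hs HA; unfold truncated_rhs.
set (beta := (n + 1) / 2).
pose proof (Rpower_pos s (- beta)) as P1; pose proof (Rpower_pos r (- beta)) as P2.
pose proof (exp_pos 1) as P3; pose proof (exp_pos (s / r)) as P4.
pose proof (Rpower_pos (theta / 2) (- n)) as P5.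
assert (HL : 0 <= (n - 1) * Rpower (theta / 2) (- n) * N).
{ repeat apply Rmult_le_pos; lra. }
assert (HB : 0 <= exp 1 * Rpower s (- beta) + Rpower r (- beta) * exp (s / r)).
{ apply Rplus_le_le_0_compat; apply Rmult_le_pos; lra. }
destruct (Rle_lt_dec s 1) as [Hs1|Hs1].
2: { rewrite !Rmax_left, !Rmult_0_l, Rminus_diag, Rabs_R0 by lra.
     now apply Rmult_le_pos. }
rewrite !Rmax_right by lra; rewrite <- Rmult_minus_distr_l, Rabs_mult.
rewrite (Rabs_pos_eq (1 - s)) by lra.
set (d := Rabs (_ - _)).
assert (Hts : 0 < theta / 2 * s) by (apply Rmult_lt_0_compat; lra).
assert (Hd : d <= (n - 1) * Rpower (theta / 2) (- n) * N * (Rpower s (- beta) * exp (s / r))).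
{ apply Rle_trans with (- (1 - n) * Rpower (theta / 2 * s) (1 - n - 1) *
    Rabs (Rmax (A1 s) (theta * s / 2) - Rmax (A2 s) (theta * s / 2))).
  - replace (theta * s / 2) with (theta / 2 * s) by field.
    unfold d; replace (theta * s / 2) with (theta / 2 * s) by field.
    apply Rpower_lipschitz; [lra|split; [exact Hts|apply Rmax_r]|apply Rmax_r].
  - replace (1 - n - 1) with (- n) by ring; rewrite <- Rpower_mult_distr by lra.
    apply Rle_trans with ((n - 1) * Rpower (theta / 2) (- n) * N *
                            (Rpower s (1 - n) * exp (s / r))).
    + replace (1 - n) with (- n + 1) at 2 by ring.
      rewrite Rpower_plus, Rpower_1 by exact Hs.
      replace ((n - 1) * Rpower (theta / 2) (- n) * N * (Rpower s (- n) * s * exp (s / r)))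
        with (- (1 - n) * (Rpower (theta / 2) (- n) * Rpower s (- n)) * (N * (s * exp (s / r)))) by ring.
      apply Rmult_le_compat_l.
      * pose proof (Rpower_pos s (- n)); repeat apply Rmult_le_pos; lra.
      * eapply Rle_trans; [apply Rmax_lipschitz|exact HA].
    + apply Rmult_le_compat_l; [exact HL|]; apply Rmult_le_compat_r; [lra|].
      apply Rpower_exponent_decr; unfold beta; lra. }
apply Rle_trans with d; [assert (0 <= d) by apply Rabs_pos; nra|].
eapply Rle_trans; [exact Hd|]; apply Rmult_le_compat_l; [exact HL|].
destruct (Rle_lt_dec s r) as [Hsr|Hsr].
- assert (exp (s / r) <= exp 1).
  { apply exp_mono; apply (Rmult_le_reg_r r); [exact Hr|].
    unfold Rdiv; rewrite Rmult_assoc, Rinv_l; lra. }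
  assert (Rpower s (- beta) * exp (s / r) <= Rpower s (- beta) * exp 1)
    by (apply Rmult_le_compat_l; lra).
  assert (0 <= Rpower r (- beta) * exp (s / r)) by (apply Rmult_le_pos; lra); lra.
- assert (Rpower s (- beta) <= Rpower r (- beta)) by (apply Rpower_decr; unfold beta; lra).
  assert (Rpower s (- beta) * exp (s / r) <= Rpower r (- beta) * exp (s / r))
    by (apply Rmult_le_compat_r; lra).
  assert (0 <= exp 1 * Rpower s (- beta)) by (apply Rmult_le_pos; lra); lra.
Qed.

(* [r] is a small radius and [a] the prescribed value of [H''(r)]; the
   condition is imposed at [r] because [H''] is unbounded at 0 for [n >= 2]. *)
Definition shot (n theta r a : R) (H H1 : R -> R) : Prop :=
  admissible (fun _ => 0) (fun x => x * exp (x / r)) H /\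
  exists H2, (forall b, triple (truncated_rhs n theta H) b theta H H1 H2) /\ H2 r = a.

Lemma le_scaled_exp (r x : R) : 0 < r -> x <= r * exp (x / r).
Proof.
intros Hr; pose proof (exp_ineq1_le (x / r)).
replace x with (r * (x / r)) at 1 by (field; lra).
apply Rmult_le_compat_l; lra.
Qed.

Lemma triple_difference (f g h0 h1 h2 k0 k1 k2 : R -> R) (theta a : R) :
  (forall b, triple f b theta h0 h1 h2) -> (forall b, triple g b theta k0 k1 k2) ->
  forall b, triple (fun x => f x - g x) b 0
    (fun x => h0 x - k0 x - a * (x ^ 2 / 2)) (fun x => h1 x - k1 x - a * x)
    (fun x => h2 x - k2 x - a).
Proof.
intros Th Tk b.
refine (triple_ext _ _ _ _ _ _ _ _ _ _ _ _ _
  (triple_comb _ _ _ _ _ _ _ _ _ _ _ (-1)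
    (triple_comb _ _ _ _ _ _ _ _ _ _ _ (-1) (Th b) (Tk b)) (triple_quadratic b 0 a))).
- intros x Hx; repeat split; ring.
- ring.
Qed.

Lemma truncated_rhs_weighted_bound (n theta r : R) (A : R -> R) (s : R) :
  1 <= n <= 3 -> 0 < theta -> 0 < s ->
  Rabs (truncated_rhs n theta A s) <= Rpower (theta / 2) (1 - n) *
    (exp 1 * Rpower s (- ((n + 1) / 2)) + Rpower r (- ((n + 1) / 2)) * exp (s / r)).
Proof.
intros Hn Ht Hs; eapply Rle_trans; [now apply truncated_rhs_bound|].
apply Rmult_le_compat_l; [left; apply Rpower_pos|].
pose proof (exp_ineq1_le 1); pose proof (Rpower_pos s (- ((n + 1) / 2))).
assert (0 <= Rpower r (- ((n + 1) / 2)) * exp (s / r)).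
{ apply Rmult_le_pos; left; [apply Rpower_pos|apply exp_pos]. }
nra.
Qed.

Section Shooting.
Variables n theta r : R.
Hypothesis Hn : 1 < n < 3.
Hypothesis Ht : 0 < theta.
Hypothesis Hr : 0 < r.
(** Lipschitz constant times gain: the contraction factor is 1/2. *)
Hypothesis Hsmall :
  (n - 1) * Rpower (theta / 2) (- n) * weight_const ((n + 1) / 2) r = 1 / 2.

Let w := fun x => x * exp (x / r).
Let C := Rpower (theta / 2) (1 - n) * weight_const ((n + 1) / 2) r.

(** Subtracting the quadratic with the same data leaves zero data and a right hand side bounded
    independently of [A] and [a]. Hence [h1 1] stays within a fixed distance of [theta + a]. *)
Lemma shot_base (A h0 h1 h2 : R -> R) (a : R) :
  (forall b, triple (truncated_rhs n theta A) b theta h0 h1 h2) -> h2 r = a ->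
  forall x, 0 < x -> Rabs (h1 x - (theta + a * x)) <= C * exp (x / r) /\
    Rabs (h0 x - (theta * x + a * (x ^ 2 / 2))) <= C * w x.
Proof.
intros T Ea x Hx.
assert (T' : forall b, triple (truncated_rhs n theta A) b 0
   (fun x => h0 x - (theta * x + a * (x ^ 2 / 2))) (fun x => h1 x - (theta + a * x))
   (fun x => h2 x - a)).
{ intros b; refine (triple_ext _ _ _ _ _ _ _ _ _ _ _ _ _
    (triple_comb _ _ _ _ _ _ _ _ _ _ _ (-1) (T b) (triple_quadratic b theta a))).
  - intros z Hz; repeat split; ring.
  - ring. }
apply (triple_weighted_bound _ _ _ _ ((n + 1) / 2) r _ ltac:(lra) Hr
         (Rlt_le _ _ (Rpower_pos _ _)) T'); [lra| |exact Hx].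
intros s Hs; apply truncated_rhs_weighted_bound; lra.
Qed.

(** With [a = 0] this is the contraction estimate; with general [a] it gives the dependence on the
    shooting parameter. *)
Lemma shot_difference (A1 A2 h0 h1 h2 k0 k1 k2 : R -> R) (a N : R) :
  (forall b, triple (truncated_rhs n theta A1) b theta h0 h1 h2) ->
  (forall b, triple (truncated_rhs n theta A2) b theta k0 k1 k2) ->
  h2 r - k2 r = a ->
  (forall x, 0 < x -> Rabs (A1 x - A2 x) <= N * w x) ->
  forall x, 0 < x -> Rabs (h1 x - k1 x - a * x) <= N / 2 * exp (x / r) /\
    Rabs (h0 x - k0 x - a * (x ^ 2 / 2)) <= N / 2 * w x.
Proof.
intros Th Tk Ea HA x Hx.
assert (HN : 0 <= N).
{ specialize (HA 1 Rlt_0_1); unfold w in HA; pose proof (exp_pos (1 / r)).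
  pose proof (Rabs_pos (A1 1 - A2 1)).
  destruct (Rle_lt_dec 0 N) as [H'|H']; [exact H'|nra]. }
pose proof (Rpower_pos (theta / 2) (- n)) as P.
replace (N / 2) with ((n - 1) * Rpower (theta / 2) (- n) * N * weight_const ((n + 1) / 2) r)
  by (replace (N / 2) with (N * (1 / 2)) by field; rewrite <- Hsmall; ring).
apply (triple_weighted_bound _ _ _ _ ((n + 1) / 2) r
         ((n - 1) * Rpower (theta / 2) (- n) * N) ltac:(lra) Hr
         ltac:(repeat apply Rmult_le_pos; lra)
         (triple_difference _ _ _ _ _ _ _ _ _ a Th Tk)); [lra| |exact Hx].
intros s Hs; apply truncated_rhs_lipschitz; try lra; now apply HA.
Qed.

Lemma weight_continuous (x : R) : continuous w x.
Proof.
apply continuous_Rmult; [apply continuous_id|].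
eapply is_derive_continuous, is_derive_exp_scale, Hr.
Qed.

Lemma weight_nonneg (x : R) : 0 < x -> 0 <= w x.
Proof. intros Hx; apply Rmult_le_pos; [lra|left; apply exp_pos]. Qed.

Lemma quadratic_weight (a x : R) : 0 < x -> Rabs (a * (x ^ 2 / 2)) <= Rabs a * r * w x.
Proof.
intros Hx; rewrite Rabs_mult, Rmult_assoc; apply Rmult_le_compat_l; [apply Rabs_pos|].
pose proof (le_scaled_exp r x Hr); unfold w.
rewrite Rabs_pos_eq by nra.
replace (r * (x * exp (x / r))) with (x * (r * exp (x / r))) by ring.
nra.
Qed.

Lemma shot_exists (a : R) : exists H H1, shot n theta r a H H1.
Proof.
set (S := fun A B : R -> R => exists h1 h2,
  (forall b, triple (truncated_rhs n theta A) b theta B h1 h2) /\ h2 r = a).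
destruct (contraction_fixpoint (fun _ => 0) w S (1 / 2) (fun _ => 0))
  as [A [B [AA [[h1 [h2 [T Eh]]] E]]]].
- lra.
- intros x _; apply weight_continuous.
- apply weight_nonneg.
- split; [intros; apply continuous_const|].
  exists 0; intros; rewrite Rminus_diag, Rabs_R0; lra.
- intros A [CA _].
  destruct (triple_exists (truncated_rhs n theta A) (Rpower (theta / 2) (1 - n)) ((n + 1) / 2))
    as [h0 [h1 [h2 T]]]; [lra|left; apply Rpower_pos| | |].
  { now apply truncated_rhs_continuous. }
  { intros x Hx; apply truncated_rhs_bound; lra. }
  (* The added quadratic imposes both the slope [theta] at 0 and [h2 r = a]. *)
  set (a' := a - h2 r).
  set (B := fun x => h0 x + 1 * (theta * x + a' * (x ^ 2 / 2))).
  assert (TB : forall b, triple (truncated_rhs n theta A) b theta B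
                 (fun x => h1 x + 1 * (theta + a' * x)) (fun x => h2 x + 1 * a')).
  { intros b; refine (triple_ext _ _ _ _ _ _ _ _ _ _ _ _ _
      (triple_comb _ _ _ _ _ _ _ _ _ _ _ 1 (T b) (triple_quadratic b theta a'))).
    - intros z Hz; repeat split; ring.
    - ring. }
  assert (Ea : h2 r + 1 * a' = a) by (unfold a'; ring).
  exists B; split; [split|].
  + intros x Hx; eapply is_derive_continuous; apply (TB x); lra.
  + exists (C + theta + Rabs a * r); intros x Hx; rewrite Rminus_0_r.
    destruct (shot_base _ _ _ _ a TB Ea x Hx) as [_ Bd].
    pose proof (quadratic_weight a x Hx) as Q.
    assert (theta * x <= theta * w x).
    { apply Rmult_le_compat_l; [lra|]; unfold w.
      assert (1 <= exp (x / r)).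
      { assert (0 < x / r) by (apply Rdiv_lt_0_compat; lra).
        pose proof (exp_ineq1_le (x / r)); lra. }
      nra. }
    assert (0 <= theta * x) by (apply Rmult_le_pos; lra).
    apply Rabs_le_between in Bd; apply Rabs_le_between in Q; apply Rabs_le; lra.
  + exists (fun x => h1 x + 1 * (theta + a' * x)), (fun x => h2 x + 1 * a'); now split.
- intros A1 A2 B1 B2 N _ _ [h1 [h2 [Th Eh]]] [k1 [k2 [Tk Ek]]] HN x Hx.
  destruct (shot_difference _ _ _ _ _ _ _ _ 0 N Th Tk ltac:(lra) HN x Hx) as [_ Bd].
  fold (w x); replace (B1 x - B2 x) with (B1 x - B2 x - 0 * (x ^ 2 / 2)) by ring; lra.
- exists A, h1; split; [exact AA|]; exists h2; split; [|exact Eh].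
  intros b; refine (triple_ext _ _ _ _ _ _ _ _ _ _ _ _ (eq_refl theta) (T b)).
  intros x Hx; repeat split; symmetry; now apply E.
Qed.

(** A bound [N] on the weighted distance of two shots improves to [Rabs (a - b) * r + N / 2], so the
    distance is at most [2 * (Rabs (a - b) * r)]; this is fed once more into the slope estimate at
    1. *)
Lemma shot_slope_lipschitz (a b : R) (H H1 G G1 : R -> R) :
  shot n theta r a H H1 -> shot n theta r b G G1 ->
  Rabs (H1 1 - G1 1) <= (1 + r * exp (1 / r)) * Rabs (a - b).
Proof.
intros [[_ [MH BH]] [H2 [TH EH]]] [[_ [MG BG]] [G2 [TG EG]]].
assert (Hd : forall x, 0 < x -> Rabs (H x - G x) <= 2 * (Rabs (a - b) * r) * w x).
{ intros x Hx.
  assert (Hw : 0 < w x) by (apply Rmult_lt_0_compat; [exact Hx|apply exp_pos]).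
  apply (Rmult_le_reg_r (/ w x)); [now apply Rinv_0_lt_compat|].
  rewrite Rmult_assoc, Rinv_r, Rmult_1_r by lra.
  apply (halving_bound (fun N => forall x, 0 < x -> Rabs (H x - G x) <= N * w x) _ _ (MH + MG)).
  - intros N HN; apply (Rmult_le_reg_r (w x)); [exact Hw|].
    rewrite Rmult_assoc, Rinv_l, Rmult_1_r by lra; now apply HN.
  - intros N HN z Hz.
    destruct (shot_difference _ _ _ _ _ _ _ _ (a - b) N TH TG ltac:(lra) HN z Hz) as [_ Bd].
    pose proof (quadratic_weight (a - b) z Hz) as Q.
    apply Rabs_le_between in Bd; apply Rabs_le_between in Q; apply Rabs_le; lra.
  - intros z Hz; specialize (BH z Hz); specialize (BG z Hz); fold (w z) in BH, BG.
    rewrite Rminus_0_r in BH, BG.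
    apply Rabs_le_between in BH; apply Rabs_le_between in BG; apply Rabs_le; lra. }
destruct (shot_difference _ _ _ _ _ _ _ _ (a - b) _ TH TG ltac:(lra) Hd 1 Rlt_0_1) as [Bd _].
replace (2 * (Rabs (a - b) * r) / 2) with (Rabs (a - b) * r) in Bd by field.
pose proof (Rle_abs (a - b)); pose proof (Rcomplements.Rabs_maj2 (a - b)).
apply Rabs_le_between in Bd; apply Rabs_le; lra.
Qed.

Lemma shot_hits : exists a H H1, shot n theta r a H H1 /\ H1 1 = 0.
Proof.
assert (Hex : forall a, exists v, exists H H1, shot n theta r a H H1 /\ H1 1 = v).
{ intros a; destruct (shot_exists a) as [H [H1 S]]; exists (H1 1), H, H1; now split. }
(* [psi] selects one shot for each [a]; the Lipschitz estimate holds for any selection and makes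
   [psi] continuous. *)
set (psi := fun a => proj1_sig (constructive_indefinite_description _ (Hex a))).
assert (Hpsi : forall a, exists H H1, shot n theta r a H H1 /\ H1 1 = psi a).
{ intros a; exact (proj2_sig (constructive_indefinite_description _ (Hex a))). }
set (K := 1 + r * exp (1 / r)).
assert (HK : 0 < K).
{ assert (0 < r * exp (1 / r)) by (apply Rmult_lt_0_compat; [exact Hr|apply exp_pos]).
  unfold K; lra. }
assert (Lip : forall a b, Rabs (psi a - psi b) <= K * Rabs (a - b)).
{ intros a b; destruct (Hpsi a) as [H [H1 [SH <-]]], (Hpsi b) as [G [G1 [SG <-]]].
  now apply (shot_slope_lipschitz a b H H1 G G1). }
assert (Cpsi : continuity psi).
{ intros a eps He; exists (eps / K); split; [now apply Rdiv_lt_0_compat|].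
  intros b [_ Hb]; simpl in *; unfold Rdist in *.
  eapply Rle_lt_trans; [apply Lip|].
  apply Rlt_le_trans with (K * (eps / K)); [now apply Rmult_lt_compat_l|].
  right; field; lra. }
set (Q := C * exp (1 / r)).
assert (Bpsi : forall a, Rabs (psi a - (theta + a)) <= Q).
{ intros a; destruct (Hpsi a) as [H [H1 [[_ [H2 [T E]]] <-]]].
  destruct (shot_base _ _ _ _ a T E 1 Rlt_0_1) as [Bd _].
  now rewrite Rmult_1_r in Bd. }
(* As [psi a] differs from [theta + a] by at most [Q], it is nonpositive at the left end and
   nonnegative at the right end. *)
destruct (IVT_gen psi (- theta - Q) (- theta + Q) 0 Cpsi) as [a [_ Ea]].
- pose proof (Bpsi (- theta - Q)) as B1; pose proof (Bpsi (- theta + Q)) as B2.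
  apply Rabs_le_between in B1; apply Rabs_le_between in B2.
  split.
  + eapply Rle_trans; [apply Rmin_l|lra].
  + eapply Rle_trans; [|apply Rmax_r]; lra.
- destruct (Hpsi a) as [H [H1 [S E]]]; exists a, H, H1; split; [exact S|lra].
Qed.

End Shooting.

Lemma profile_exists_shooting (n theta : R) :
  1 < n < 3 -> 0 < theta -> exists h0 h1 h2, profile n theta h0 h1 h2.
Proof.
intros Hn Ht.
(* [D] is the contraction factor without its power of [r]; [r] is then chosen to make the product
   1/2. *)
set (D := (n - 1) * Rpower (theta / 2) (- n) *
          ((n + 1) / 2 / ((n + 1) / 2 - 1) * (exp 1 / (2 - (n + 1) / 2) + 1))).
assert (HD : 0 < D).
{ pose proof (exp_pos 1).
  assert (0 < exp 1 / (2 - (n + 1) / 2)) by (apply Rdiv_lt_0_compat; lra).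
  assert (0 < (n + 1) / 2 / ((n + 1) / 2 - 1)) by (apply Rdiv_lt_0_compat; lra).
  pose proof (Rpower_pos (theta / 2) (- n)).
  unfold D; apply Rmult_lt_0_compat; apply Rmult_lt_0_compat; lra. }
set (r := Rpower (1 / (2 * D)) (/ (2 - (n + 1) / 2))).
assert (Er : Rpower r (2 - (n + 1) / 2) = 1 / (2 * D)).
{ unfold r; rewrite Rpower_mult, Rinv_l, Rpower_1; [reflexivity| |lra].
  apply Rdiv_lt_0_compat; lra. }
destruct (shot_hits n theta r Hn Ht (Rpower_pos _ _)) as [a [H [H1 [[_ [H2 [T _]]] E]]]].
{ unfold weight_const; rewrite Er; unfold D; field.
  repeat split; try lra; try apply Rgt_not_eq, Rpower_pos.
  pose proof (exp_pos 1); lra. }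
(* The slope vanishes at 1, so the linear lower bound holds and the truncation is inactive on
   [(0, 1]]. *)
pose proof (triple_linear_lower _ _ _ _ _ (T 1)
  (fun x _ => truncated_rhs_nonneg n theta H x) E) as L.
assert (HL : forall x, 0 < x <= 1 -> theta * x / 2 <= H x /\ 0 < H x).
{ intros x Hx; specialize (L x Hx).
  assert (0 <= theta * (x - x ^ 2)) by (apply Rmult_le_pos; nra).
  assert (0 < theta * x) by (apply Rmult_lt_0_compat; lra); lra. }
exists H, H1, H2; split; [|split; [apply HL|exact E]].
apply (triple_ext_rhs (truncated_rhs n theta H)); [|apply T].
intros x Hx; destruct (HL x Hx) as [HLx _]; unfold truncated_rhs.
rewrite Rmax_right by lra; rewrite Rmax_left by lra; reflexivity.
Qed.

Lemma profile_exists (n theta : R) :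
  (theta = 0 /\ 0 < n < 3 / 2) \/ (0 < theta /\ 0 < n < 3) ->
  exists h0 h1 h2, profile n theta h0 h1 h2.
Proof.
intros [[-> Hn]|[Ht Hn]].
- apply (profile_exists_contraction n 0 2); lra.
- destruct (Rle_lt_dec n 1).
  + apply (profile_exists_contraction n theta 1); lra.
  + apply profile_exists_shooting; lra.
Qed.

(** * Orbits and profiles *)

Lemma is_derive_pair (U V : NormedModule R_AbsRing) (f : R -> U) (g : R -> V)
    (x : R) (lf : U) (lg : V) :
  is_derive f x lf -> is_derive g x lg ->
  is_derive (V := prod_NormedModule R_AbsRing U V) (fun t => (f t, g t)) x (lf, lg).
Proof.
intros Df Dg.
refine (filterdiff_comp'_2 f g (fun (a : U) (b : V) => (a, b)) x _ _ (fun a b => (a, b)) Df Dg _).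
refine (filterdiff_ext_lin _ _ _ _ _).
- refine (filterdiff_ext (fun t : prod_NormedModule R_AbsRing U V => t) _ _ _ _).
  + now intros [a b].
  + apply filterdiff_id.
- now intros [a b].
Qed.

Lemma is_derive_fst (U V : NormedModule R_AbsRing)
    (f : R -> prod_NormedModule R_AbsRing U V) (x : R) (l : prod_NormedModule R_AbsRing U V) :
  is_derive f x l -> is_derive (fun t => fst (f t)) x (fst l).
Proof.
intros Df.
exact (filterdiff_comp' f fst x _ fst Df (filterdiff_linear _ is_linear_fst)).
Qed.

Lemma is_derive_snd (U V : NormedModule R_AbsRing)
    (f : R -> prod_NormedModule R_AbsRing U V) (x : R) (l : prod_NormedModule R_AbsRing U V) :
  is_derive f x l -> is_derive (fun t => snd (f t)) x (snd l).
Proof.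
intros Df.
exact (filterdiff_comp' f snd x _ snd Df (filterdiff_linear _ is_linear_snd)).
Qed.

Definition glue (c : R) (g k : R -> R) (x : R) : R := if Rle_dec x c then g x else k x.

Lemma glue_right (c : R) (g k : R -> R) (x : R) : g c = k c -> c <= x -> glue c g k x = k x.
Proof.
intros E Hx; unfold glue; destruct (Rle_dec x c); [|reflexivity].
now replace x with c by lra.
Qed.

(** At the junction both branches have two-sided derivatives with equal values, so the difference
    quotients of the glued function converge from both sides. *)
Lemma is_derive_glue (c : R) (g k g' k' : R -> R) (x : R) :
  (x <= c -> is_derive g x (g' x)) -> (c <= x -> is_derive k x (k' x)) ->
  g c = k c -> g' c = k' c -> is_derive (glue c g k) x (glue c g' k' x).
Proof.
intros Dg Dk E E'; destruct (Rtotal_order x c) as [Hx|[->|Hx]].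
- unfold glue at 2; destruct (Rle_dec x c); [|lra].
  apply (is_derive_ext_loc g); [|now apply Dg].
  generalize (open_lt c x Hx); apply filter_imp; intros z Hz.
  unfold glue; destruct (Rle_dec z c); [reflexivity|lra].
- rewrite glue_right by (assumption || lra).
  specialize (Dg (Rle_refl c)); specialize (Dk (Rle_refl c)); rewrite E' in Dg.
  apply is_derive_Reals in Dg; apply is_derive_Reals in Dk; apply is_derive_Reals.
  intros eps He; destruct (Dg eps He) as [d1 H1], (Dk eps He) as [d2 H2].
  exists (mkposreal _ (Rmin_pos _ _ (cond_pos d1) (cond_pos d2))); simpl; intros h Hh Hd.
  rewrite (glue_right c g k c) by (assumption || lra).
  pose proof (Rmin_l d1 d2); pose proof (Rmin_r d1 d2).
  unfold glue; destruct (Rle_dec (c + h) c).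
  + rewrite <- E; apply H1; lra.
  + apply H2; lra.
- rewrite glue_right by (assumption || lra).
  apply (is_derive_ext_loc k); [|apply Dk; lra].
  generalize (open_gt c x Hx); apply filter_imp; intros z Hz.
  rewrite glue_right; [reflexivity|exact E|lra].
Qed.

(** The point 1 is excluded because iterated [Derive] looks at a neighbourhood, and a triple says
    nothing to the right of its end point. *)
Lemma triple_Derive (f h0 h1 h2 : R -> R) (theta x : R) :
  triple f 1 theta h0 h1 h2 -> 0 < x < 1 ->
  is_derive (Derive_n h0 0) x (h1 x) /\ is_derive (Derive_n h0 1) x (h2 x) /\
  is_derive (Derive_n h0 2) x (- f x).
Proof.
intros [D _] Hx.
assert (Hloc : forall z, 0 < z < 1 -> locally z (fun y => 0 < y < 1)).
{ intros z Hz; apply (open_and (fun y => 0 < y) (fun y => y < 1));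
    [apply open_gt|apply open_lt|exact Hz]. }
assert (E1 : forall z, 0 < z < 1 -> h1 z = Derive_n h0 1 z).
{ intros z Hz; symmetry; apply is_derive_unique, D; lra. }
assert (D1 : forall z, 0 < z < 1 -> is_derive (Derive_n h0 1) z (h2 z)).
{ intros z Hz; apply (is_derive_ext_loc h1); [|apply D; lra].
  generalize (Hloc z Hz); apply filter_imp; exact E1. }
assert (E2 : forall z, 0 < z < 1 -> h2 z = Derive_n h0 2 z).
{ intros z Hz; symmetry; now apply is_derive_unique, D1. }
split; [apply D; lra|split; [now apply D1|]].
apply (is_derive_ext_loc h2); [|apply D; lra].
generalize (Hloc x Hx); apply filter_imp; exact E2.
Qed.

Lemma profile_positive_solution (n theta delta : R) (h0 h1 h2 : R -> R) :
  profile n theta h0 h1 h2 -> delta < 1 -> positive_solution n delta h0.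
Proof.
intros [T [P _]] Hd x Hx.
destruct (triple_Derive _ _ _ _ _ x T) as [D0 [D1 D2]]; [lra|].
split; [apply P; lra|split].
- intros k Hk; destruct k as [|[|[|[|k]]]]; try lia; simpl.
  + exact I.
  + now exists (h1 x).
  + now exists (h2 x).
  + eexists; exact D2.
- rewrite (is_derive_unique _ _ _ D2 : Derive_n h0 3 x = _).
  replace (Rpower (h0 x) (n - 1) * - ((1 - x) * Rpower (h0 x) (1 - n)))
    with ((x - 1) * (Rpower (h0 x) (n - 1) * Rpower (h0 x) (1 - n))) by ring.
  rewrite <- Rpower_plus; replace (n - 1 + (1 - n)) with 0 by ring.
  rewrite Rpower_O by (apply P; lra); ring.
Qed.

Lemma profile_connecting_orbit (n theta delta : R) (h0 h1 h2 : R -> R) :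
  profile n theta h0 h1 h2 -> 0 < delta < 1 ->
  connecting_orbit n theta delta
    (fun p => exists x, delta <= x <= 1 /\ p = (x, h0 x, h1 x, h2 x)).
Proof.
intros HP Hd; pose proof HP as [T [P E]].
exists (1 - delta), (fun t => (delta + t, h0 (delta + t), h1 (delta + t), h2 (delta + t))).
split; [lra|split; [|split; [|split]]].
- intros t Ht; simpl.
  assert (Hx : 0 < delta + t <= 1) by lra.
  pose proof (P _ Hx) as Ph; split; [now left|].
  destruct T as [D _]; destruct (D _ Hx) as [D0 [D1 D2]].
  assert (Sh : forall (u : R -> R) l, is_derive u (delta + t) l ->
                is_derive (fun s => u (delta + s)) t l).
  { intros u l Hu; replace l with (scal (0 + 1) l) by (unfold scal; simpl; unfold mult; simpl; ring).
    apply (is_derive_comp u (fun s => delta + s)); [exact Hu|].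
    apply (is_derive_plus (fun _ => delta) (fun s => s)).
    - apply (is_derive_const (K := R_AbsRing) (V := R_NormedModule)).
    - apply (is_derive_id (K := R_AbsRing)). }
  unfold rpow; destruct (Rlt_dec 0 (h0 (delta + t))); [|lra].
  replace (Rpower (h0 (delta + t)) (1 - n) * (delta + t - 1))
    with (- ((1 - (delta + t)) * Rpower (h0 (delta + t)) (1 - n))) by ring.
  repeat apply is_derive_pair.
  + apply (Sh (fun s => s)), (is_derive_id (K := R_AbsRing)).
  + now apply Sh.
  + now apply Sh.
  + now apply Sh.
- exists h0; split; [|split; [split|]].
  + apply (profile_positive_solution n theta delta h0 h1 h2); [exact HP|lra].
  + apply right_limit_filterlim, T.
  + apply right_limit_filterlim; apply (right_limit_ext h1); [|apply T].
    exists 1; split; [lra|]; intros x Hx; symmetry; apply is_derive_unique, T; lra.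
  + destruct (triple_Derive _ _ _ _ _ delta T Hd) as [D0 [D1 _]].
    rewrite Rplus_0_r.
    rewrite (is_derive_unique _ _ _ D0 : Derive h0 delta = _).
    now rewrite (is_derive_unique _ _ _ D1 : Derive_n h0 2 delta = _).
- split; simpl; [lra|].
  now replace (delta + (1 - delta)) with 1 by ring.
- intros p; split.
  + intros [x [Hx ->]]; exists (x - delta); split; [lra|].
    now replace (delta + (x - delta)) with x by ring.
  + intros [t [Ht ->]]; exists (delta + t); split; [lra|reflexivity].
Qed.

(** Since [x' = 1], time is [x - delta], so the orbit is a graph over [[delta, 1]]. It is glued to
    the solution on [(0, delta]] that witnesses [B_delta]. The data up to order two agree at
    [delta], and the third derivatives agree there by the equation. *)
Lemma connecting_orbit_profile (n theta delta : R) (O : phase_space -> Prop) :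
  0 < delta < 1 -> connecting_orbit n theta delta O -> positive_orbit O ->
  exists h0 h1 h2, profile n theta h0 h1 h2 /\
    forall p, O p <-> exists x, delta <= x <= 1 /\ p = (x, h0 x, h1 x, h2 x).
Proof.
intros Hd [T [u [HT [Tr [[H [PS [[L0 L1] Eu]]] [[BX B1'] HO]]]]]] PO.
set (X := fun t => fst (fst (fst (u t)))).
set (U0 := fun t => snd (fst (fst (u t)))).
set (U1 := fun t => snd (fst (u t))).
set (U2 := fun t => snd (u t)).
assert (EU : forall t, u t = (X t, U0 t, U1 t, U2 t)).
{ intros t; unfold X, U0, U1, U2; now destruct (u t) as [[[? ?] ?] ?]. }
assert (PU : forall t, 0 <= t <= T -> 0 < U0 t).
{ intros t Ht; assert (Ot : O (u t)) by (apply HO; now exists t).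
  specialize (PO _ Ot); now rewrite EU in PO. }
assert (DU : forall t, 0 <= t <= T -> is_derive X t 1 /\ is_derive U0 t (U1 t) /\
   is_derive U1 t (U2 t) /\ is_derive U2 t (Rpower (U0 t) (1 - n) * (X t - 1))).
{ intros t Ht; destruct (Tr t Ht) as [_ D]; rewrite (EU t) in D; simpl in D.
  unfold rpow in D; destruct (Rlt_dec 0 (U0 t)) as [_|C]; [|now destruct C; apply PU].
  pose proof (is_derive_snd _ _ _ _ _ D) as D2; apply is_derive_fst in D.
  pose proof (is_derive_snd _ _ _ _ _ D) as D1; apply is_derive_fst in D.
  pose proof (is_derive_snd _ _ _ _ _ D) as D0; apply is_derive_fst in D.
  exact (conj D (conj D0 (conj D1 D2))). }
rewrite EU in Eu; injection Eu as EX E0 E1 E2.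
assert (HX : forall t, 0 <= t <= T -> X t = delta + t).
{ intros t [[Ht| <-] Ht']; [|lra].
  destruct (mean_value X (fun _ => 1) 0 t Ht) as [c [_ Ec]]; [|lra].
  intros z Hz; apply DU; lra. }
rewrite EU in BX, B1'; simpl in BX, B1'.
rewrite HX in BX by lra.
assert (ET : T = 1 - delta) by lra.
assert (DH : forall x, 0 < x <= delta -> 0 < H x /\ is_derive H x (Derive H x) /\
   is_derive (Derive H) x (Derive_n H 2 x) /\
   is_derive (Derive_n H 2) x (- ((1 - x) * Rpower (H x) (1 - n)))).
{ intros x Hx; destruct (PS x Hx) as [Ph [Ex E3]].
  split; [exact Ph|split; [|split]].
  - apply Derive_correct, (Ex 1%nat); lia.
  - apply (Derive_correct (Derive_n H 1)), (Ex 2%nat); lia.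
  - replace (- ((1 - x) * Rpower (H x) (1 - n))) with (Derive_n H 3 x).
    + apply (Derive_correct (Derive_n H 2)), (Ex 3%nat); lia.
    + replace (- ((1 - x) * Rpower (H x) (1 - n))) with ((-1 + x) * Rpower (H x) (1 - n)) by ring.
      rewrite <- E3.
      replace (Rpower (H x) (n - 1) * Derive_n H 3 x * Rpower (H x) (1 - n))
        with (Derive_n H 3 x * (Rpower (H x) (n - 1) * Rpower (H x) (1 - n))) by ring.
      rewrite <- Rpower_plus; replace (n - 1 + (1 - n)) with 0 by ring.
      rewrite Rpower_O by exact Ph; ring. }
set (sh := fun (v : R -> R) x => v (x - delta)).
assert (Dsh : forall v v' x, is_derive v (x - delta) v' -> is_derive (sh v) x v').
{ intros v v' x Hv; unfold sh.
  replace v' with (scal (1 - 0) v') by (unfold scal; simpl; unfold mult; simpl; ring).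
  apply (is_derive_comp v (fun s => s - delta)); [exact Hv|].
  apply (is_derive_minus (fun s => s) (fun _ => delta)).
  - apply (is_derive_id (K := R_AbsRing)).
  - apply (is_derive_const (K := R_AbsRing) (V := R_NormedModule)). }
assert (S0 : H delta = sh U0 delta) by (unfold sh; now rewrite Rminus_diag).
assert (S1 : Derive H delta = sh U1 delta) by (unfold sh; now rewrite Rminus_diag).
assert (S2 : Derive_n H 2 delta = sh U2 delta) by (unfold sh; now rewrite Rminus_diag).
set (h0 := glue delta H (sh U0)).
set (h1 := glue delta (Derive H) (sh U1)).
set (h2 := glue delta (Derive_n H 2) (sh U2)).
assert (Hh : forall x, delta <= x -> h0 x = U0 (x - delta) /\ h1 x = U1 (x - delta) /\
               h2 x = U2 (x - delta)).
{ intros x Hx; unfold h0, h1, h2; now rewrite !glue_right by assumption. }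
exists h0, h1, h2; split; [split; [split; [|split]|split]|].
- intros x Hx; split; [|split].
  + apply is_derive_glue; auto; intros Hxd; [apply DH; lra|].
    apply Dsh, DU; lra.
  + apply is_derive_glue; auto; intros Hxd; [apply DH; lra|].
    apply Dsh, DU; lra.
  + replace (- ((1 - x) * Rpower (h0 x) (1 - n)))
      with (glue delta (fun x => - ((1 - x) * Rpower (H x) (1 - n)))
              (fun x => - ((1 - x) * Rpower (sh U0 x) (1 - n))) x)
      by (unfold h0, glue; destruct (Rle_dec x delta); reflexivity).
    apply is_derive_glue; auto; [intros Hxd; apply DH; lra| |now rewrite S0].
    intros Hxd; apply Dsh.
    replace (- ((1 - x) * Rpower (sh U0 x) (1 - n)))
      with (Rpower (U0 (x - delta)) (1 - n) * (X (x - delta) - 1))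
      by (rewrite HX by lra; unfold sh; ring).
    apply DU; lra.
- apply (right_limit_ext H); [|now apply right_limit_filterlim].
  exists delta; split; [lra|]; intros x Hx.
  unfold h0, glue; destruct (Rle_dec x delta); [reflexivity|lra].
- apply (right_limit_ext (Derive H)); [|now apply right_limit_filterlim].
  exists delta; split; [lra|]; intros x Hx.
  unfold h1, glue; destruct (Rle_dec x delta); [reflexivity|lra].
- intros x Hx; destruct (Rle_lt_dec x delta) as [Hxd|Hxd].
  + unfold h0, glue; destruct (Rle_dec x delta); [apply DH; lra|lra].
  + destruct (Hh x ltac:(lra)) as [-> _]; apply PU; lra.
- destruct (Hh 1 ltac:(lra)) as [_ [-> _]]; rewrite <- ET; exact B1'.
- intros p; rewrite HO; split.
  + intros [t [Ht ->]]; exists (delta + t); split; [lra|].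
    destruct (Hh (delta + t) ltac:(lra)) as [-> [-> ->]].
    replace (delta + t - delta) with t by ring.
    now rewrite EU, HX.
  + intros [x [Hx ->]]; exists (x - delta); split; [lra|].
    destruct (Hh x ltac:(lra)) as [-> [-> ->]].
    rewrite EU, HX by lra.
    now replace (delta + (x - delta)) with x by ring.
Qed.

Theorem proposition5p3 (theta n : R)
    (Hparam : (theta = 0 /\ 0 < n < 3 / 2) \/ (0 < theta /\ 0 < n < 3)) :
  exists delta0 : R, 0 < delta0 /\
    forall delta : R, 0 < delta < delta0 ->
      (exists O : phase_space -> Prop, connecting_orbit n theta delta O) /\
      (forall O1 O2 : phase_space -> Prop,
         connecting_orbit n theta delta O1 -> positive_orbit O1 ->
         connecting_orbit n theta delta O2 -> positive_orbit O2 ->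
         forall p : phase_space, O1 p <-> O2 p).
Proof.
(* Every [delta] below 1 works, as the profile does not depend on [delta]; at 1 itself [Derive_n] of
   a profile is not controlled. *)
exists 1; split; [lra|]; intros delta Hd; split.
- destruct (profile_exists n theta Hparam) as [h0 [h1 [h2 HP]]].
  eexists; exact (profile_connecting_orbit n theta delta h0 h1 h2 HP Hd).
- intros O1 O2 C1 P1 C2 P2 p.
  destruct (connecting_orbit_profile n theta delta O1 Hd C1 P1) as [h0 [h1 [h2 [Hh E1]]]].
  destruct (connecting_orbit_profile n theta delta O2 Hd C2 P2) as [g0 [g1 [g2 [Hg E2]]]].
  rewrite E1, E2.
  assert (E : forall x, delta <= x <= 1 -> h0 x = g0 x /\ h1 x = g1 x /\ h2 x = g2 x).
  { intros x Hx; apply (profile_unique n theta h0 h1 h2 g0 g1 g2); auto; lra. }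
  split; intros [x [Hx ->]]; exists x; (split; [exact Hx|]);
    destruct (E x Hx) as [-> [-> ->]]; reflexivity.
Qed.
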